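(* Let $(P_m)_{m\ge1}$ be a sequence of finite posets with $n_m=|P_m|\to\infty$. Suppose that one of the following holds: (a) $w(P_m)/\sqrt{n_m}\to\infty$; (b) $\mathrm{height}(P_m)/n_m\to 0$; (c) $\frac{1}{n_m}\sum_{x\in P_m} h(x)/\alpha(x)\to\infty$; (d) $\frac{1}{n_m}\log e(P_m)\to\infty$; (e) for each $m$ there is a fractional matching $\lambda$ of $\mathcal{A}(P_m)$ with $\frac{1}{n_m}\sum_{A\in\mathcal{A}(P_m)}\lambda_A|A|^2\to\infty$. Then $\liminf_m \delta(P_m)\ge 1/e$, i.e. $\delta(P_m)>1/e-o(1)$.
   Context: For a finite poset $P$ with $n$ elements, a linear extension is an order-preserving bijection $f:P\to\{1,\dots,n\}$; $E(P)$ is the set of linear extensions, $e(P)=|E(P)|$, and $f$ denotes a uniform member of $E(P)$. For distinct $x,y$, $\delta_{xy}=\min\{\Pr(f(x)<f(y)),\Pr(f(y)<f(x))\}$ and $\delta(P)=\max_{x\ne y}\delta_{xy}$. $h(x)=\mathbb{E}f(x)$; $\alpha(x)=|\{y\in P:y\le x\}|$. $w(P)$ is the width (largest antichain size), $\mathrm{height}(P)$ is the maximum number of elements of a chain. $\mathcal{A}(P)$ is the set of antichains of $P$; a fractional matching of $\mathcal{A}(P)$ is $\lambda:\mathcal{A}(P)\to[0,1]$ with $\sum_{A\ni x}\lambda_A\le 1$ for every $x\in P$. *)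

(* Defs.v *)
From mathcomp Require Import all_boot all_order all_algebra.
From mathcomp Require Import all_classical all_reals all_analysis.

Set Implicit Arguments.
Unset Strict Implicit.
Unset Printing Implicit Defensive.

Import Order.TTheory GRing.Theory Num.Theory.
Import numFieldNormedType.Exports.

Local Open Scope classical_set_scope.
Local Open Scope ring_scope.

Section FinitePoset.
Variables (R : realType) (d : Order.disp_t) (T : finPOrderType d).
Implicit Types (x y : T) (A : {set T}).

(* Values are shifted by one: ['I_#|T|] is {0, ..., n - 1}, so the label of x
   in {1, ..., n} is [(f x).+1] (see [label]). *)
Definition linear_extension (f : {ffun T -> 'I_#|T|}) : Prop :=
  bijective f /\ forall x y, (x <= y)%O -> (f x <= f y)%N.

Definition linexts : {set {ffun T -> 'I_#|T|}} :=
  [set f | `[< linear_extension f >]]%SET.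

Definition label (f : {ffun T -> 'I_#|T|}) x : nat := (f x).+1.

Definition nlinexts : nat := #|linexts|.

Definition prob_lt x y : R :=
  #|[set f in linexts | (label f x < label f y)%N]%SET|%:R / nlinexts%:R.

Definition balance_pair x y : R := Num.min (prob_lt x y) (prob_lt y x).

(* As [balance_pair] is nonnegative, the default value 0 only matters when T
   has at most one element. *)
Definition balance : R :=
  \big[Num.max/0]_(p : T * T | p.1 != p.2) balance_pair p.1 p.2.

Definition avg_height x : R :=
  (\sum_(f in linexts) (label f x)%:R) / nlinexts%:R.

Definition down_card x : nat := #|[set y | (y <= x)%O]%SET|.

Definition antichain A : bool :=
  [forall x in A, forall y in A, (x >=< y)%O ==> (x == y)].

Definition chain A : bool := [forall x in A, forall y in A, (x >=< y)%O].

Definition width : nat := (\max_(A : {set T} | antichain A) #|A|)%N.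

Definition height : nat := (\max_(A : {set T} | chain A) #|A|)%N.

(* Only the values of lam on antichains are constrained, and only these are
   ever used. *)
Definition fractional_matching (lam : {set T} -> R) : Prop :=
  (forall A, antichain A -> 0 <= lam A <= 1) /\
  (forall x, \sum_(A : {set T} | antichain A && (x \in A)) lam A <= 1).

End FinitePoset.

Arguments nlinexts {d} T.
Arguments balance R {d} T.
Arguments avg_height R {d} {T} x.
Arguments width {d} T.
Arguments height {d} T.

(* Main.v *)
(** The uniform measure on the linear extensions of a poset T with n elements is
    compared with the uniform measure on the set [omega T N] of order-preserving
    maps u : T -> {0, ..., N}, for N very large compared with n: up to a
    negligible set of non-injective maps, such a u is a linear extension together
    with an increasing n-tuple of values.

    By the four functions theorem, k |-> #{u | u x - u y <= k} is log-concave.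
    This gives a discrete Grünbaum inequality: if P(u x <= u y) < e^(-1-eta), then
    E|u x - u y| <= (1 + 2/eta) E(u x - u y). Hence, if the balance constant is
    less than e^(-1-eta) and the elements are sorted by their mean value, the path
    visiting them in this order has mean total variation E sum |u x_(i+1) - u x_i|
    at most K N, with K depending on eta only.

    Let the room of x in u be the set of values that can be given to x when the
    rest of u is kept. Conditionally on the rest, u x is uniform on the room, so
    E|u x - u y| >= (E|room x| - 1) / 4 and thus sum_x E|room x| = O(K N). But
    - E|room x| >= E(u x) / alpha(x), and E(u x) is of order h(x) N / n;
    - on an antichain A, sum_(a in A) E|room a| >= |A|^2 N / (2n), because
      sum_(a in A) E(1 / |room a|) is at most the relative growth of
      #|omega T N| from N to N + 1, which is about n / N;
    so the quantities in (a), (b), (c) and (e) are bounded; for (b), apply the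
    second estimate to the level sets of Mirsky's theorem. For (d), a partition
    function bounds the number of maps u with a short path. *)
Require Import Defs.
From mathcomp Require Import all_boot all_order all_algebra.
From mathcomp Require Import all_classical all_reals all_analysis.
From mathcomp Require Import zify ring lra.
From mathcomp Require Import fintype finset.

Import Order.TTheory GRing.Theory Num.Theory.
Import numFieldNormedType.Exports.

Set Implicit Arguments.
Unset Strict Implicit.
Unset Printing Implicit Defensive.

Local Open Scope ring_scope.

(** * The four functions theorem *)

Lemma card_ord_lt (m a : nat) : (a <= m)%N -> #|[set c : 'I_m | (c < a)%N]| = a.
Proof.
move=> am; have winj : injective (widen_ord am).
  by move=> i j /(congr1 val) /= h; apply: val_inj.
rewrite -[RHS]card_ord -(card_image winj).
apply: eq_card => c; rewrite inE; apply/idP/imageP => [ca|[i _ ->]].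
  by exists (Ordinal ca) => //; apply/val_inj.
by rewrite /= ltn_ord.
Qed.

Lemma card_dep_pairs (A B : finType) (P : pred A) (Q : A -> pred B) :
  #|[set p : A * B | P p.1 && Q p.1 p.2]| = (\sum_(a | P a) #|[set b | Q a b]|)%N.
Proof.
rewrite -sum1_card (eq_bigl (fun p : A * B => P p.1 && Q p.1 p.2)).
  rewrite -(pair_big_dep P Q (fun _ _ => 1%N))/=.
  by apply: eq_bigr => a _; rewrite -sum1_card; apply: eq_bigl => b; rewrite inE.
by move=> p; rewrite inE.
Qed.

Section Update.
Variables (I : finType) (A : Type).

Definition upd (u : {ffun I -> A}) (x : I) (c : A) : {ffun I -> A} :=
  [ffun z => if z == x then c else u z].

Lemma updE u x c z : upd u x c z = if z == x then c else u z.
Proof. by rewrite ffunE. Qed.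

Lemma upd_same u x c : upd u x c x = c.
Proof. by rewrite updE eqxx. Qed.

Lemma upd_id u x : upd u x (u x) = u.
Proof. by apply/ffunP => z; rewrite updE; case: eqP => [->|]. Qed.

Lemma upd_upd u x c e : upd (upd u x c) x e = upd u x e.
Proof. by apply/ffunP => z; rewrite !updE; case: eqP. Qed.

End Update.

(** * Sums over maps, taken one coordinate at a time *)

Section IteratedSums.
Variables (R : realFieldType) (I : finType) (M : nat).
Local Notation V := {ffun I -> 'I_M}.
Implicit Types (f : V -> R) (u v : V) (s : seq I).

(** Coordinates outside [s] stay frozen at their values in [u]. This form allows induction on the
    coordinates, both for the four functions theorem and for the partition function of a path. *)
Fixpoint itersum s f u : R :=
  if s is x :: s' then \sum_(c < M) itersum s' f (upd u x c) else f u.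

Lemma itersumE s f u : uniq s ->
  itersum s f u = \sum_(v : V | [forall z, (z \in s) || (v z == u z)]) f v.
Proof.
elim: s u => [|x s IHs] u /=.
  move=> _; rewrite (eq_bigl (pred1 u)) ?big_pred1_eq// => v.
  apply/forallP/eqP => [e|-> z]; last by rewrite eqxx.
  by apply/ffunP => z; apply/eqP/e.
move=> /andP[xs us]; rewrite (partition_big (fun v : V => v x) predT)//=.
apply: eq_bigr => c _; rewrite IHs//; apply: eq_bigl => v.
apply/forallP/andP => [H|[/forallP H /eqP vx] z].
- split.
    apply/forallP => z; move: (H z); rewrite updE inE.
    by case: (z =P x) => [->|] /=.
  by move: (H x); rewrite (negbTE xs) updE eqxx.
- move: (H z); rewrite updE inE; case: (z =P x) => [-> _|_ /=//].
  by rewrite vx eqxx orbT.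
Qed.

Lemma itersum_enum f u : itersum (enum I) f u = \sum_v f v.
Proof.
rewrite itersumE ?enum_uniq//; apply: eq_bigl => v.
by apply/forallP => z; rewrite mem_enum.
Qed.

End IteratedSums.

Section FourFunctions.
Variables (R : realFieldType).

(** [P * (P + Q) - P * (X + Y)] is at least [(P - X) * (P - Y)], hence nonnegative; when [P = 0],
    both [X] and [Y] vanish. *)
Lemma add_le_of_mul_le (X Y P Q : R) : 0 <= X -> 0 <= Y -> 0 <= P -> 0 <= Q ->
  X <= P -> Y <= P -> X * Y <= P * Q -> X + Y <= P + Q.
Proof.
move=> X0 Y0 P0 Q0 XP YP XY.
have [P1|P1] := eqVneq P 0; first by lra.
have Pp : 0 < P by rewrite lt_def P1.
rewrite -(ler_pM2l Pp).
have : 0 <= (P - X) * (P - Y) by rewrite mulr_ge0// subr_ge0.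
nra.
Qed.

(** After symmetrisation, a pair [a <= b] contributes [X + Y] with [X = f1 a * f2 b] and
    [Y = f1 b * f2 a], to be compared with [P = f3 a * f4 b] and [Q = f3 b * f4 a]. The hypothesis
    bounds [X] and [Y] by [P], and its diagonal cases give [X * Y <= P * Q]. *)
Lemma four_functions_chain (M : nat) (f1 f2 f3 f4 : 'I_M -> R) :
  (forall a, 0 <= f1 a) -> (forall a, 0 <= f2 a) ->
  (forall a, 0 <= f3 a) -> (forall a, 0 <= f4 a) ->
  (forall a b : 'I_M, f1 a * f2 b <= f3 (Order.min a b) * f4 (Order.max a b)) ->
  (\sum_a f1 a) * (\sum_a f2 a) <= (\sum_a f3 a) * (\sum_a f4 a).
Proof.
move=> p1 p2 p3 p4 H.
have sym (g h : 'I_M -> R) : 2 * ((\sum_a g a) * (\sum_a h a)) =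
    \sum_a \sum_b (g a * h b + g b * h a).
  rewrite [RHS](eq_bigr (fun a => g a * (\sum_b h b) + (\sum_b g b) * h a)); last first.
    by move=> a _; rewrite big_split/= -mulr_sumr -mulr_suml.
  by rewrite big_split/= -mulr_suml -mulr_sumr; ring.
have two : (0 : R) < 2 by [].
rewrite -(ler_pM2l two) !sym; apply: ler_sum => a _; apply: ler_sum => b _.
wlog ab : a b / (a <= b)%O.
  move=> W; case: (leP a b) => [/W//|/ltW/W].
  by rewrite addrC [X in _ <= X]addrC.
apply: add_le_of_mul_le; rewrite ?mulr_ge0//.
- by have := H a b; rewrite (min_l ab) (max_r ab).
- by have := H b a; rewrite (min_r ab) (max_l ab).
- have := H a a; have := H b b; rewrite !minxx !maxxx => Hb Ha.
  have := ler_pM (mulr_ge0 (p1 a) (p2 a)) (mulr_ge0 (p1 b) (p2 b)) Ha Hb.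
  by congr (_ <= _); ring.
Qed.

Variables (I : finType) (M : nat).
Local Notation V := {ffun I -> 'I_M}.

Definition fmeet (u v : V) : V := [ffun z => Order.min (u z) (v z)].
Definition fjoin (u v : V) : V := [ffun z => Order.max (u z) (v z)].

(** Summing out one coordinate preserves the four functions hypothesis, by the case of a chain. *)
Lemma four_functions_itersum s (f1 f2 f3 f4 : V -> R) :
  (forall u, 0 <= f1 u) -> (forall u, 0 <= f2 u) ->
  (forall u, 0 <= f3 u) -> (forall u, 0 <= f4 u) ->
  (forall u v, f1 u * f2 v <= f3 (fmeet u v) * f4 (fjoin u v)) ->
  forall u v, itersum s f1 u * itersum s f2 v <=
    itersum s f3 (fmeet u v) * itersum s f4 (fjoin u v).
Proof.
move=> p1 p2 p3 p4 H.
have pos s' f u : (forall u, 0 <= f u) -> 0 <= itersum s' f u :> R.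
  by move=> pf; elim: s' u => //= x s'' IH u; apply: sumr_ge0.
elim: s => [//|x s IHs] u v /=.
apply: four_functions_chain => [a|a|a|a|a b]; try exact: pos.
apply: le_trans (IHs _ _) _.
suff [-> ->] : fmeet (upd u x a) (upd v x b) = upd (fmeet u v) x (Order.min a b)
    /\ fjoin (upd u x a) (upd v x b) = upd (fjoin u v) x (Order.max a b) by [].
by split; apply/ffunP => z; rewrite !ffunE; case: eqP.
Qed.

End FourFunctions.

Lemma four_functions_card (I : finType) (M : nat) (A B C D : {set {ffun I -> 'I_M}}) :
  (forall u v, u \in A -> v \in B -> fmeet u v \in C /\ fjoin u v \in D) ->
  (#|A| * #|B| <= #|C| * #|D|)%N.
Proof.
move=> H; rewrite -(ler_nat rat) !natrM.
pose V := {ffun I -> 'I_M}.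
have cardE (X : {set V}) : #|X|%:R = \sum_u (u \in X)%:R :> rat.
  by rewrite -sum1_card natr_sum big_mkcond/=; apply: eq_bigr => u _; case: (u \in X).
rewrite !cardE.
(* Iterated sums need a base point [u0]; if there is no map at all, every sum is empty. *)
have [/existsP[u0 _]|V0] := boolP [exists u : V, true]; last first.
  have e (f : V -> rat) : \sum_u f u = 0.
    by rewrite big1// => u _; case/negP: V0; apply/existsP; exists u.
  by rewrite !e !mul0r.
have pos (X : {set V}) u : 0 <= (u \in X)%:R :> rat by rewrite ler0n.
rewrite -(itersum_enum (fun u => (u \in A)%:R) u0).
rewrite -(itersum_enum (fun u => (u \in B)%:R) u0).
rewrite -(itersum_enum (fun u => (u \in C)%:R) (fmeet u0 u0)).
rewrite -(itersum_enum (fun u => (u \in D)%:R) (fjoin u0 u0)).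
apply: four_functions_itersum => // u v.
case: (boolP (u \in A)) => uA; last by rewrite mul0r mulr_ge0.
case: (boolP (v \in B)) => vB; last by rewrite mulr0 mulr_ge0.
by have [-> ->] := H u v uA vB.
Qed.

(** * Order-preserving maps into a finite chain *)

Section Omega.
Variables (d : Order.disp_t) (T : finPOrderType d) (N : nat).
Local Notation V := {ffun T -> 'I_N.+1}.
Implicit Types (u : V) (x y z : T).

Definition omega : {set V} :=
  [set u : V | [forall x, forall y, (x <= y)%O ==> (u x <= u y)%N]].

Lemma omegaP u : reflect (forall x y, (x <= y)%O -> (u x <= u y)%N) (u \in omega).
Proof.
rewrite inE; apply: (iffP forallP) => [H x y xy|H x].
  by have /forallP/(_ y)/implyP := H x; apply.
by apply/forallP => y; apply/implyP; apply: H.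
Qed.

Lemma leN u z : (u z <= N)%N.
Proof. by rewrite -ltnS. Qed.

Variables (x y : T).

(** Counts the [u] with [u x - u y <= k - N]; the shift by [N] avoids negative numbers. *)
Definition cumul k : nat := #|[set u in omega | (u x + N <= u y + k)%N]|.

(* In the coordinates w z = b + u z - u y, the lower end of the box becomes the
   extra coordinate w None = b - u y, and the condition u x - u y <= k - N
   involves the single coordinate w x. *)
Let enc (b : nat) u : {ffun option T -> 'I_(N.*2.+4)} :=
  [ffun o => if o is Some z then inord (b + u z - u y) else inord (b - u y)].

(** The image under [enc b] of the maps counted by [cumul k], when [N < b <= N.+2]. Different [b]
    give translates of one set. *)
Let slab (b k : nat) : {set {ffun option T -> 'I_(N.*2.+4)}} :=
  [set w : {ffun option T -> 'I_(N.*2.+4)} |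
     [&& (w (Some y) == b :> nat), (w (Some x) + N <= b + k)%N,
     [forall z, (w None <= w (Some z) <= w None + N)%N] &
     [forall z1, forall z2, (z1 <= z2)%O ==> (w (Some z1) <= w (Some z2))%N]]].

Let slabP b k (w : {ffun option T -> 'I_(N.*2.+4)}) : reflect
  [/\ w (Some y) = b :> nat, (w (Some x) + N <= b + k)%N,
      (forall z, w None <= w (Some z) <= w None + N)%N &
      (forall z1 z2, (z1 <= z2)%O -> (w (Some z1) <= w (Some z2))%N)]
  (w \in slab b k).
Proof.
rewrite inE.
apply: (iffP and4P) => [[/eqP a1 a2 /forallP a3 a4]|[a1 a2 a3 a4]]; split => //.
- by move=> z1 z2 z12; have /forallP/(_ z1)/forallP/(_ z2)/implyP := a4; apply.
- exact/eqP.
- exact/forallP.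
- by apply/forallP => z1; apply/forallP => z2; apply/implyP/a4.
Qed.

Let enc_Some b u z : (N < b <= N.+2)%N -> enc b u (Some z) = (b + u z - u y)%N :> nat.
Proof. by move=> hb; rewrite ffunE inordK//; have := leN u z; have := leN u y; lia. Qed.

Let enc_None b u : (N < b <= N.+2)%N -> enc b u None = (b - u y)%N :> nat.
Proof. by move=> hb; rewrite ffunE inordK//; have := leN u y; lia. Qed.

Let enc_slab b k u : (N < b <= N.+2)%N -> u \in omega ->
  (u x + N <= u y + k)%N -> enc b u \in slab b k.
Proof.
move=> hb /omegaP um ux; apply/slabP.
have := leN u y; have := leN u x => ux' uy'.
rewrite !(enc_Some _ _ hb) (enc_None _ hb); split; [lia|lia| |].
  by move=> z; rewrite (enc_Some _ _ hb); have := leN u z; lia.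
by move=> z1 z2 /um; rewrite !(enc_Some _ _ hb); lia.
Qed.

Let card_slab b k : (N < b <= N.+2)%N -> #|slab b k| = cumul k.
Proof.
move=> hb; rewrite /cumul.
have inj : injective (enc b).
  move=> u v /ffunP e; apply/ffunP => z; apply/val_inj => /=.
  have /(congr1 val) /= := e None; have /(congr1 val) /= := e (Some z).
  rewrite !enc_Some// !enc_None//.
  by have := leN u z; have := leN u y; have := leN v z; have := leN v y; lia.
rewrite -(card_imset _ inj); congr (#|pred_of_set _|); apply/setP => w.
apply/slabP/imsetP => [[wy wx wb wm]|[u]].
- have [g gE] : exists g : T -> nat, forall z, w (Some z) = g z :> nat.
    by exists (fun z => nat_of_ord (w (Some z))).
  have [m mE] : exists m : nat, w None = m :> nat by exists (nat_of_ord (w None)).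
  have {}wb z : (m <= g z <= m + N)%N by rewrite -mE -gE.
  have {}wm z1 z2 : (z1 <= z2)%O -> (g z1 <= g z2)%N by rewrite -!gE; apply: wm.
  rewrite gE in wy; rewrite gE in wx.
  pose u : V := [ffun z => inord (g z - m)].
  have uE z : u z = (g z - m)%N :> nat.
    by rewrite ffunE inordK//; have := wb z; lia.
  exists u.
    rewrite inE; apply/andP; split.
      by apply/omegaP => z1 z2 /wm; rewrite !uE; lia.
    by rewrite !uE; have := wb x; have := wb y; lia.
  apply/ffunP => -[z|]; apply/val_inj => /=.
    by rewrite enc_Some// !uE gE; have := wb z; have := wb y; lia.
  by rewrite enc_None// !uE mE; have := wb y; lia.
- by rewrite inE => /andP[uO ux] ->; apply/slabP/enc_slab.
Qed.

(** The translates by [N.+2] and [N.+1] make the thresholds fit: the coordinate of [x] is at most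
    [i + 2] in [u] and [j + 2] in [v], hence also in the meet and in the join respectively, while
    the coordinate of [y] becomes [N.+1] in the meet and [N.+2] in the join. *)
Let slab_lattice i j (u v : {ffun option T -> 'I_(N.*2.+4)}) : (i <= j)%N ->
  u \in slab N.+2 i -> v \in slab N.+1 j.+1 ->
  fmeet u v \in slab N.+1 i.+1 /\ fjoin u v \in slab N.+2 j.
Proof.
move=> ij /slabP[uy ux ub um] /slabP[vy vx vb vm].
have mE o : fmeet u v o = minn (u o) (v o) :> nat.
  by rewrite ffunE minEle leEord; case: leqP.
have jE o : fjoin u v o = maxn (u o) (v o) :> nat.
  by rewrite ffunE maxEle leEord; case: leqP.
split; apply/slabP; (split; [| |move=> z|move=> z1 z2 z12]); rewrite ?mE ?jE.
- lia.
- lia.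
- by have := ub z; have := vb z; lia.
- by have := um _ _ z12; have := vm _ _ z12; lia.
- lia.
- lia.
- by have := ub z; have := vb z; lia.
- by have := um _ _ z12; have := vm _ _ z12; lia.
Qed.

Lemma cumul_log_concave i j : (i <= j)%N ->
  (cumul i * cumul j.+1 <= cumul i.+1 * cumul j)%N.
Proof.
move=> ij; have h1 : (N < N.+1 <= N.+2)%N by lia.
have h2 : (N < N.+2 <= N.+2)%N by lia.
rewrite -(card_slab i h2) -(card_slab j.+1 h1) -(card_slab i.+1 h1) -(card_slab j h2).
by apply: four_functions_card => u v; apply: slab_lattice.
Qed.

End Omega.

(** * A discrete Grünbaum inequality *)

Section Grunbaum.
Variables (R : realType).

Lemma ln_le_subr1 (x : R) : 0 < x -> ln x <= x - 1.
Proof.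
by move=> x0; have := @le_ln1Dx R (x - 1); rewrite [1 + _]addrC subrK; apply; lra.
Qed.

(** The function t ln t - t is convex with derivative ln t; its graph lies above the tangent at
    [b]. *)
Lemma xlnx_tangent (a b : R) : 0 <= a <= b ->
  (b * ln b - b) - (a * ln a - a) <= (b - a) * ln b.
Proof.
move=> /andP[a0 ab]; have [->|an0] := eqVneq a 0.
  by rewrite mul0r !subr0 lerBlDr lerDl; apply: le_trans ab.
have ap : 0 < a by rewrite lt_def an0.
have bp : 0 < b by exact: lt_le_trans ab.
have := ln_le_subr1 (divr_gt0 bp ap).
rewrite ln_div ?posrE// -(ler_pM2l ap) mulrBr mulrBr mulrCA divff ?gt_eqF// !mulr1.
by lra.
Qed.

Variables (U : finType) (Om : {set U}) (D : U -> nat).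

Definition level_le k : {set U} := [set u in Om | (D u <= k)%N].
Local Notation F k := (#|level_le k|).

Lemma level_le_sub i j : (i <= j)%N -> level_le i \subset level_le j.
Proof. by move=> ij; apply/subsetP => u; rewrite !inE => /andP[-> /leq_trans->]. Qed.

Lemma card_level_le i j : (i <= j)%N -> (F i <= F j)%N.
Proof. by move=> ij; apply/subset_leq_card/level_le_sub. Qed.

Lemma card_level_leT k : (F k <= #|Om|)%N.
Proof. by apply: subset_leq_card; apply/subsetP => u; rewrite inE => /andP[]. Qed.

(** A discrete form of the integral of ln t from 0 to [F k]: each new level is added by the tangent
    inequality for t ln t - t. *)
Lemma sum_ln_level k :
  (F k)%:R * ln (F k)%:R - (F k)%:R <= \sum_(u in level_le k) ln (F (D u))%:R :> R.
Proof.
elim: k => [|k IHk].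
  have -> : \sum_(u in level_le 0) ln (F (D u))%:R = (F 0)%:R * ln (F 0)%:R :> R.
    rewrite (eq_bigr (fun=> ln (F 0)%:R)).
      by rewrite sumr_const mulr_natl.
    by move=> u; rewrite inE leqn0 => /andP[_ /eqP->].
  by rewrite gerBl.
rewrite (big_setID (level_le k))/= (setIidPr (level_le_sub (leqnSn k))).
have -> : \sum_(u in level_le k.+1 :\: level_le k) ln (F (D u))%:R =
    ((F k.+1)%:R - (F k)%:R) * ln (F k.+1)%:R :> R.
  rewrite (eq_bigr (fun=> ln (F k.+1)%:R)).
    rewrite sumr_const -natrB ?card_level_le// mulr_natl cardsD.
    by rewrite (setIidPr (level_le_sub (leqnSn k))).
  move=> u; rewrite !inE => /andP[h1 /andP[uO h2]].
  by congr (ln (F _)%:R); move: h1; rewrite uO /=; lia.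
have := @xlnx_tangent (F k)%:R (F k.+1)%:R.
by rewrite ler0n ler_nat card_level_le// => /(_ isT); lra.
Qed.

Hypothesis log_concave : forall i j, (i <= j)%N -> (F i * F j.+1 <= F i.+1 * F j)%N.

Variable (c : nat).
Hypothesis Fc0 : (0 < F c)%N.
Let q : R := (F c.+1)%:R / (F c)%:R.

Let FcR : 0 < (F c)%:R :> R. Proof. by rewrite ltr0n. Qed.
Let FcS : 0 < (F c.+1)%:R :> R.
Proof. by rewrite ltr0n; apply: leq_trans _ (card_level_le (leqnSn c)). Qed.
Let q1 : 1 <= q.
Proof. by rewrite ler_pdivlMr// mul1r ler_nat card_level_le. Qed.
Let q0 : 0 < q. Proof. exact: lt_le_trans q1. Qed.

Let ratio_above k : (c <= k)%N -> (F k.+1)%:R <= q * (F k)%:R.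
Proof.
move=> ck; rewrite /q mulrAC ler_pdivlMr// -!natrM ler_nat mulnC.
exact: log_concave.
Qed.

Let ratio_below k : (k <= c)%N -> q * (F k)%:R <= (F k.+1)%:R.
Proof.
move=> ck; rewrite /q mulrAC ler_pdivrMr// -!natrM ler_nat mulnC.
exact: log_concave.
Qed.

(** By log-concavity, ln F lies below the line of slope [ln q] through its point at [c.+1], on both
    sides of that point. *)
Let ln_level_le k : (0 < F k)%N ->
  ln (F k)%:R <= ln (F c.+1)%:R + ln q * (k%:R - c.+1%:R) :> R.
Proof.
move=> Fk.
have [ck|kc] := leqP c.+1 k.
  elim: k ck Fk => // k IHk; rewrite leq_eqVlt => /orP[/eqP<- _|ck _].
    by rewrite subrr mulr0 addr0.
  have Fk : (0 < F k)%N by apply: leq_trans _ (card_level_le (ltnW (ck : (c < k)%N))).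
  have FkR : 0 < (F k)%:R :> R by rewrite ltr0n.
  have := IHk ck Fk.
  have : ln (F k.+1)%:R <= ln q + ln (F k)%:R.
    rewrite -lnM ?posrE// ler_ln ?posrE ?(mulr_gt0 q0)//.
      exact/ratio_above/ltnW.
    by rewrite ltr0n; apply: leq_trans _ (card_level_le (leqnSn k)).
  by rewrite (_ : k.+1%:R = k%:R + 1 :> R); [lra|rewrite natr1].
move: kc Fk; rewrite ltnS => kc.
rewrite -(subKn kc); have := leq_subr k c; move: (c - k)%N => e.
elim: e => [|e IHe] ec; rewrite ?subn0.
  move=> _; rewrite -natr1 opprD addNKr mulrN1 /q ln_div ?posrE//; lra.
move=> Fk; set j := (c - e.+1)%N in Fk *.
have ej : (c - e)%N = j.+1 by rewrite /j; lia.
have Fj : (0 < F j.+1)%N by apply: leq_trans _ (card_level_le (leqnSn j)).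
have := IHe (ltnW ec); rewrite ej => /(_ Fj).
have : ln q + ln (F j)%:R <= ln (F j.+1)%:R.
  rewrite -lnM ?posrE ?ltr0n// ler_ln ?posrE ?(mulr_gt0 q0) ?ltr0n//.
  by apply: ratio_below; rewrite /j leq_subr.
by rewrite (_ : j.+1%:R = j%:R + 1 :> R); [lra|rewrite natr1].
Qed.

(* The truncated difference c.+1 - D u counts the levels below c.+1 that
   contain u. *)
Let sum_deficit : (\sum_(u in Om) (c.+1 - D u) = \sum_(k < c.+1) F k)%N.
Proof.
under [RHS]eq_bigr do rewrite -sum1_card big_mkcond/=.
rewrite exchange_big/= [LHS]big_mkcond/=; apply: eq_bigr => u _.
case: (boolP (u \in Om)) => uO; last by rewrite big1// => k _; rewrite inE (negbTE uO).
under eq_bigr do rewrite inE uO/=.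
elim: c.+1 => [|m IHm]; first by rewrite big_ord0 sub0n.
by rewrite big_ord_recr/= -IHm; case: leqP => h; lia.
Qed.

(** Below [c], log-concavity gives [(q - 1) * F k <= F k.+1 - F k], and these differences telescope;
    moreover [ln q <= q - 1]. *)
Let ln_q_deficit : ln q * (\sum_(u in Om) (c.+1 - D u))%N%:R <= #|Om|%:R.
Proof.
rewrite sum_deficit.
have lnq : ln q <= q - 1 by exact: ln_le_subr1.
apply: (@le_trans _ _ ((q - 1) * (\sum_(k < c.+1) F k)%N%:R)).
  by rewrite ler_wpM2r.
have : forall m, (m <= c.+1)%N -> (q - 1) * (\sum_(k < m) F k)%N%:R <= (F m)%:R.
  elim=> [|m IHm] mc; first by rewrite big_ord0 mulr0.
  have := IHm (ltnW mc); have := ratio_below mc.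
  by rewrite big_ord_recr/= natrD; lra.
move=> /(_ _ (leqnn _)) /le_trans; apply.
by rewrite ler_nat card_level_leT.
Qed.

Variables (Z : nat) (eta : R).
Hypothesis DZ : forall u, u \in Om -> (D u <= Z)%N.
Hypothesis eta0 : 0 < eta.
Hypothesis small : (F c.+1)%:R < expR (- 1 - eta) * #|Om|%:R.

Let Om0 : (0 < #|Om|)%N.
Proof. by apply: leq_trans _ (card_level_leT c). Qed.

(** The mean of ln F(D u) is at least [ln #|Om| - 1] and, by the supporting line, at most
    [ln (F c.+1)] plus [ln q] times the mean of [D u - c.+1]. As [ln (F c.+1) < ln #|Om| - 1 - eta],
    the last term exceeds [eta]; the bound on the deficit then has the same factor [ln q], which
    cancels. *)
Lemma grunbaum_deviation_pos :
  eta * (\sum_(u in Om) (c.+1 - D u))%N%:R <= \sum_(u in Om) ((D u)%:R - c.+1%:R) :> R.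
Proof.
have OmR : 0 < #|Om|%:R :> R by rewrite ltr0n.
have OmE : level_le Z = Om.
  by apply/setP => u; rewrite inE; case: (boolP (u \in Om)) => //= /DZ ->.
have := sum_ln_level Z; rewrite OmE => low.
have up : \sum_(u in Om) ln (F (D u))%:R <=
    #|Om|%:R * ln (F c.+1)%:R + ln q * \sum_(u in Om) ((D u)%:R - c.+1%:R) :> R.
  apply: (@le_trans _ _ (\sum_(u in Om) (ln (F c.+1)%:R + ln q * ((D u)%:R - c.+1%:R)))).
    apply: ler_sum => u uO; apply: ln_level_le.
    by apply/card_gt0P; exists u; rewrite inE uO leqnn.
  by rewrite big_split/= sumr_const mulr_natl -mulr_sumr.
have lnF : ln (F c.+1)%:R < - 1 - eta + ln #|Om|%:R.
  rewrite -[- 1 - eta]expRK -lnM ?posrE ?expR_gt0//.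
  by rewrite ltr_ln ?posrE ?mulr_gt0 ?expR_gt0.
set S := \sum_(u in Om) _ in up *.
have lnq0 : 0 <= ln q by exact: ln_ge0.
have main : eta * #|Om|%:R < ln q * S.
  have : #|Om|%:R * ln (F c.+1)%:R < #|Om|%:R * (- 1 - eta + ln #|Om|%:R).
    by rewrite ltr_pM2l.
  by rewrite mulrDr mulrBr mulrN1; lra.
have lnqp : 0 < ln q.
  rewrite lt_def lnq0 andbT; apply/eqP => e; move: main.
  by rewrite e mul0r ltNge mulr_ge0// ltW.
rewrite -(ler_pM2l lnqp) mulrCA; apply: le_trans (ltW main).
by rewrite ler_pM2l.
Qed.

End Grunbaum.

Lemma grunbaum_abs (R : realType) (U : finType) (Om : {set U}) (D : U -> nat)
    (c Z : nat) (eta : R) :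
  let F k := #|level_le Om D k| in
  (forall i j, (i <= j)%N -> (F i * F j.+1 <= F i.+1 * F j)%N) ->
  (forall u, u \in Om -> (D u <= Z)%N) -> 0 < eta ->
  (F c.+1)%:R < expR (- 1 - eta) * #|Om|%:R ->
  \sum_(u in Om) `|(D u)%:R - c.+1%:R| <=
    (1 + 2 / eta) * \sum_(u in Om) ((D u)%:R - c.+1%:R) :> R.
Proof.
move=> F lc DZ eta0 small.
(* The absolute value is the signed value plus twice its negative part. *)
have absE u : `|(D u)%:R - c.+1%:R| = ((D u)%:R - c.+1%:R) + 2 * (c.+1 - D u)%N%:R :> R.
  have [h|h] := leqP (D u) c.+1.
    by rewrite natrB// ler0_norm ?subr_le0 ?ler_nat//; ring.
  have -> : (c.+1 - D u = 0)%N by apply/eqP; rewrite subn_eq0 ltnW.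
  by rewrite mulr0 addr0 ger0_norm// subr_ge0 ler_nat ltnW.
rewrite (eq_bigr _ (fun u _ => absE u)) big_split/= -mulr_sumr -natr_sum.
rewrite [leRHS]mulrDl mul1r.
rewrite lerD2l.
have [Fc0|Fc0] := posnP (F c).
  have D0 u : u \in Om -> (c < D u)%N.
    move=> uO; rewrite ltnNge; apply/negP => h.
    by have := cards0_eq Fc0 => /setP/(_ u); rewrite !inE uO h.
  rewrite big1 ?mulr0//; last by move=> u /D0; lia.
  apply: mulr_ge0; first by rewrite divr_ge0// ltW.
  apply: sumr_ge0 => u /D0 h.
  by rewrite subr_ge0 ler_nat.
have := grunbaum_deviation_pos lc Fc0 DZ eta0 small.
rewrite -ler_pdivlMl// mulrC => h.
by rewrite -[2 / eta * _]mulrA ler_wpM2l// mulrC.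
Qed.

(** * Rooms *)

Section SumDistances.

Lemma natr_dist (R : realFieldType) (a b : nat) :
  `|a%:R - b%:R| = ((a - b) + (b - a))%N%:R :> R.
Proof.
have [h|h] := leqP a b.
  rewrite (_ : (a - b) + (b - a) = b - a)%N; last by lia.
  by rewrite natrB// distrC ger0_norm// subr_ge0 ler_nat.
rewrite (_ : (a - b) + (b - a) = a - b)%N; last by lia.
by rewrite natrB ?(ltnW h)// ger0_norm// subr_ge0 ler_nat ltnW.
Qed.

Lemma sum_near_le (M a t : nat) :
  (\sum_(c < M) ((a <= c + t) && (c <= a + t)) <= t.*2.+1)%N.
Proof.
suff : (\sum_(c < M) ((a <= c + t) && (c <= a + t)) <= minn M (a + t).+1 - (a - t))%N.
  by lia.
elim: M => [|M IHM]; first by rewrite big_ord0.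
rewrite big_ord_recr/=; apply: leq_trans (leq_add IHM (leqnn _)) _.
by case: leqP; case: leqP; lia.
Qed.

(** Raising [t] by one adds at most one unit on a window of [t.*2.+1] points, and the sum of the
    first t odd numbers is t^2. *)
Lemma sum_tent_le (M a t : nat) :
  (\sum_(c < M) (t - ((c - a) + (a - c))) <= t ^ 2)%N.
Proof.
elim: t => [|t IHt]; first by rewrite big1.
rewrite (eq_bigr (fun c : 'I_M => (t - ((c - a) + (a - c))) +
   ((a <= c + t) && (c <= a + t)))%N).
  rewrite big_split/=; apply: leq_trans (leq_add IHt (sum_near_le M a t)) _.
  by rewrite -mul2n; nia.
by move=> c _; case: leqP; case: leqP; lia.
Qed.

(** A distance is at least [t] minus the tent of height [t], so the sum is at least [L * t - t ^ 2]
    with [L] the size of [S]; half of [L], rounded down, is the best [t]. *)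
Lemma sum_dist_ge (R : realFieldType) (M a : nat) (S : {set 'I_M}) :
  (#|S|%:R ^+ 2 - 1) / 4 <= \sum_(c in S) `|c%:R - a%:R| :> R.
Proof.
under eq_bigr do rewrite natr_dist.
rewrite -natr_sum.
set X := (\sum_(c in S) _)%N; set L := #|S|; pose t := L./2.
have tent : (\sum_(c in S) (t - ((c - a) + (a - c))) <= t ^ 2)%N.
  apply: leq_trans (sum_tent_le M a t).
  by rewrite big_mkcond /=; apply: leq_sum => c _; case: ifP.
have LX : (L * t <= X + t ^ 2)%N.
  apply: leq_trans (leq_add (leqnn X) tent).
  by rewrite -sum_nat_const -big_split/=; apply: leq_sum => c _; lia.
have L2 : (L ^ 2 <= 4 * X + 1)%N.
  have := odd_double_half L; rewrite -/t -muln2.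
  by case: (odd L) => /= tE; rewrite -tE in LX *; nia.
have : (L ^ 2)%:R <= (4 * X + 1)%:R :> R by rewrite ler_nat.
by rewrite natrX natrD natrM => {}L2; rewrite ler_pdivrMr//; lra.
Qed.

End SumDistances.

Section Rooms.
Variables (R : realFieldType) (d : Order.disp_t) (T : finPOrderType d) (N : nat).
Local Notation V := {ffun T -> 'I_N.+1}.
Implicit Types (u v : V) (x y z : T).

Definition room u x : {set 'I_N.+1} := [set c | upd u x c \in omega T N].

Lemma room_upd u x c : room (upd u x c) x = room u x.
Proof. by apply/setP => e; rewrite !inE upd_upd. Qed.

Lemma room_self u x : u \in omega T N -> u x \in room u x.
Proof. by move=> uO; rewrite inE upd_id. Qed.

Lemma card_room_gt0 u x : u \in omega T N -> (0 < #|room u x|)%N.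
Proof. by move=> uO; apply/card_gt0P; exists (u x); apply: room_self. Qed.

(** Resampling the value at [x] uniformly in its room preserves the uniform measure: exchanging the
    old and the new value is an involution on pairs. *)
Lemma sum_resample x (phi : V -> R) :
  \sum_(u in omega T N) (\sum_(c in room u x) phi (upd u x c)) / #|room u x|%:R =
  \sum_(u in omega T N) phi u.
Proof.
under eq_bigr do rewrite mulr_suml.
rewrite pair_big_dep/=.
pose h (p : V * 'I_N.+1) := (upd p.1 x p.2, p.1 x).
have hK : involutive h.
  by case=> u c; rewrite /h/= upd_same upd_upd upd_id.
rewrite (reindex_inj (inv_inj hK))/=.
rewrite (eq_big (fun p : V * 'I_N.+1 => (p.1 \in omega T N) && (p.2 \in room p.1 x))
   (fun p : V * 'I_N.+1 => phi p.1 / #|room p.1 x|%:R)).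
- rewrite -(pair_big_dep (fun u => u \in omega T N) (fun u c => c \in room u x)
    (fun u c => phi u / #|room u x|%:R))/=.
  apply: eq_bigr => u uO; rewrite sumr_const -[LHS]mulr_natr divfK//.
  by rewrite pnatr_eq0 -lt0n card_room_gt0.
- by case=> u c /=; rewrite room_upd !inE upd_id andbC.
- by case=> u c /= _; rewrite room_upd upd_upd upd_id.
Qed.

(** Resampling [u x] leaves [u y] fixed; for a room of size L, the mean distance is at least (L^2 -
    1) / (4 L), which is at least (L - 1) / 4. *)
Lemma sum_dist_room x y : x != y ->
  \sum_(u in omega T N) (#|room u x|%:R - 1) / 4 <=
  \sum_(u in omega T N) `|(u x)%:R - (u y)%:R| :> R.
Proof.
move=> xy; rewrite -[leRHS](sum_resample x); apply: ler_sum => u uO.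
under eq_bigr do rewrite upd_same updE eq_sym (negbTE xy).
have L0 : 0 < #|room u x|%:R :> R by rewrite ltr0n card_room_gt0.
have L1 : 1 <= #|room u x|%:R :> R by rewrite ler1n card_room_gt0.
rewrite ler_pdivlMr//; apply: le_trans (sum_dist_ge R (u y) (room u x)).
by rewrite mulrAC ler_pM2r ?invr_gt0//; nra.
Qed.

Definition at_bottom u x : bool := [forall c in room u x, (u x <= c)%N].

(** Every room has a least value, which resampling hits with probability one over the size of the
    room. *)
Lemma sum_inv_room x :
  \sum_(u in omega T N) (#|room u x|%:R)^-1 <=
  #|[set u in omega T N | at_bottom u x]|%:R :> R.
Proof.
rewrite -sum1_card natr_sum.
rewrite [leRHS](eq_bigl (fun u => (u \in omega T N) && at_bottom u x)); last first.
  by move=> u; rewrite inE.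
rewrite big_mkcondr/= -[leRHS](sum_resample x); apply: ler_sum => u uO.
rewrite ler_pdivlMr ?ltr0n ?card_room_gt0// mulVf ?pnatr_eq0 -?lt0n ?card_room_gt0//.
have [c cr cmin] := arg_minnP (fun c : 'I_N.+1 => nat_of_ord c) (room_self x uO).
rewrite (bigD1 c)//= (_ : at_bottom _ _).
  by rewrite lerDl sumr_ge0// => e _; case: ifP.
by apply/forall_inP => e; rewrite room_upd upd_same => /cmin.
Qed.

End Rooms.

(** * Growth of the order polynomial *)

Section OrderPolynomial.
Variables (d : Order.disp_t) (T : finPOrderType d) (N : nat).
Local Notation V := {ffun T -> 'I_N.+1}.
Local Notation V' := {ffun T -> 'I_N.+2}.
Implicit Types (u : V) (x y z : T) (A B : {set T}).

Definition collapse (v : V') (c : 'I_N.+2) : V :=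
  [ffun z => inord (v z - (c < v z)%N)].

Lemma collapseE (v : V') (c : 'I_N.+2) z : v z != c ->
  collapse v c z = (v z - (c < v z))%N :> nat.
Proof.
move=> vc; rewrite ffunE inordK//.
have := ltn_ord (v z); have := ltn_ord c.
have : nat_of_ord (v z) != c by [].
by case: (ltngtP (v z) c) => // h _; lia.
Qed.

Lemma collapseK (v : V') (c : 'I_N.+2) z : v z != c ->
  v z = (collapse v c z + (c <= collapse v c z))%N :> nat.
Proof.
move=> vc; rewrite collapseE//; have : nat_of_ord (v z) != c by [].
by case: (ltngtP (v z) c) => // h _; lia.
Qed.

Lemma collapse_le (v : V') (c : 'I_N.+2) y z : v y != c -> v z != c ->
  (v y <= v z)%N -> (collapse v c y <= collapse v c z)%N.
Proof.
move=> yc zc; rewrite !collapseE//.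
have : nat_of_ord (v y) != c by []. have : nat_of_ord (v z) != c by [].
by case: (ltngtP (v y) c) => // h1; case: (ltngtP (v z) c) => // h2; lia.
Qed.

(** Each map into N + 2 values misses at least N + 2 - n of them; deleting a missed value [c] from
    the codomain is injective on pairs (map, [c]). *)
Lemma omega_ratio :
  (#|omega T N.+1| * (N.+2 - #|T|) <= #|omega T N| * N.+2)%N.
Proof.
pose D := [set p : V' * 'I_N.+2 | (p.1 \in omega T N.+1) && (p.2 \notin codom p.1)].
apply: (@leq_trans #|D|).
  rewrite -sum_nat_const.
  have -> : #|D| = (\sum_(v in omega T N.+1) #|[pred c | c \notin codom v]|)%N.
    rewrite (card_dep_pairs (mem (omega T N.+1)) (fun v c => c \notin codom v)).
    by apply: eq_bigr => v _; apply: eq_card => c; rewrite inE.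
  apply: leq_sum => v _; rewrite -[in leqLHS](card_ord N.+2) -(cardC (mem (codom v))).
  rewrite leq_subLR; apply: leq_add; first exact: leq_image_card.
  by rewrite leq_eqVlt; apply/orP; left; apply/eqP/eq_card.
pose h (p : V' * 'I_N.+2) := (collapse p.1 p.2, p.2).
have neq (p : V' * 'I_N.+2) z : p \in D -> p.1 z != p.2.
  by rewrite inE => /andP[_]; apply: contraNneq => <-; apply: codom_f.
have hinj : {in D &, injective h}.
  move=> [v c] [v' c'] vD vD' [/ffunP e ec]; subst c'; congr pair.
  apply/ffunP => z; apply/val_inj => /=.
  rewrite (collapseK (neq _ z vD)) (collapseK (neq _ z vD')).
  by have /= := e z => ->.
rewrite -(card_in_imset hinj).
apply: (@leq_trans #|setX (omega T N) [set: 'I_N.+2]|); last first.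
  by rewrite cardsX cardsT card_ord.
apply: subset_leq_card; apply/subsetP => _ /imsetP[[v c] vD ->].
rewrite !inE /= andbT; apply/forallP => x; apply/forallP => y; apply/implyP => xy.
have := vD; rewrite inE => /andP[/omegaP/(_ _ _ xy)/= vxy _].
exact: collapse_le (neq _ x vD) (neq _ y vD) vxy.
Qed.

Definition raise B u : V' := [ffun z => inord (u z + (z \in B))].

Lemma raiseE B u z : raise B u z = (u z + (z \in B))%N :> nat.
Proof. by rewrite ffunE inordK//; have := leN u z; case: (z \in B); lia. Qed.

Lemma raise_inj B : injective (raise B).
Proof.
move=> u v /ffunP e; apply/ffunP => z; have /(congr1 val) := e z.
by rewrite /= !raiseE => /addIn/val_inj.
Qed.

Lemma raise_omega B u : (forall y z, (y <= z)%O -> y \in B -> z \in B) ->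
  u \in omega T N -> raise B u \in omega T N.+1.
Proof.
move=> up /omegaP um; apply/omegaP => y z yz; rewrite !raiseE.
by have := um _ _ yz; have := up _ _ yz; case: (y \in B) => [->//|_]; lia.
Qed.

(* Raising the filter generated by A maps omega N into omega N.+1; raising all
   of it except one of its minimal elements a, when a is at the bottom of its
   room, produces maps not obtained in this way, and distinct for distinct a. *)
Lemma omega_antichain_step A : antichain A ->
  (#|omega T N| + \sum_(a in A) #|[set u in omega T N | at_bottom u a]|
     <= #|omega T N.+1|)%N.
Proof.
move=> Aanti.
have anti a b : a \in A -> b \in A -> (a <= b)%O -> a = b.
  move=> aA bA ab; apply/eqP.
  have /forall_inP/(_ a aA)/forall_inP/(_ b bA)/implyP := Aanti; apply.
  by rewrite comparable_sym; apply: ge_comparable.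
pose F := [set z | [exists a in A, (a <= z)%O]].
have Fup y z : (y <= z)%O -> y \in F -> z \in F.
  move=> yz; rewrite !inE => /exists_inP[a aA ay].
  by apply/exists_inP; exists a => //; apply: le_trans yz.
have AF a : a \in A -> a \in F by move=> aA; rewrite inE; apply/exists_inP; exists a.
have Faup a y z : a \in A -> (y <= z)%O -> y \in F :\ a -> z \in F :\ a.
  move=> aA yz; rewrite !in_setD1 => /andP[ya yF]; rewrite (Fup _ _ yz yF) andbT.
  apply: contraNneq ya => za; subst z; move: yF; rewrite inE => /exists_inP[b bA by_].
  have ab := anti _ _ bA aA (le_trans by_ yz); subst b.
  by apply/eqP/le_anti; rewrite yz by_.
pose D := [set p : T * V | (p.1 \in A) && ((p.2 \in omega T N) && at_bottom p.2 p.1)].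
have DE p : (p \in D) = [&& p.1 \in A, p.2 \in omega T N & at_bottom p.2 p.1].
  by rewrite inE.
pose h (p : T * V) := raise (F :\ p.1) p.2.
(* If [a] and [b] differ, equal images force [u a = (v a).+1] and [u = v] off [a] and [b];
   incomparability of [a] and [b] then puts [v a] in the room of [a] in [u], below the bottom. *)
have core a b (u v : V) : a \in A -> b \in A -> u \in omega T N -> v \in omega T N ->
    at_bottom u a -> raise (F :\ a) u = raise (F :\ b) v -> (a, u) = (b, v).
  move=> aA bA uO vO ub e.
  have [ab|ab] := eqVneq a b.
    by subst b; congr pair; apply: raise_inj e.
  have E z : (u z + (z \in F :\ a) = v z + (z \in F :\ b))%N.
    by rewrite -!raiseE; congr (nat_of_ord _); move/ffunP: e; apply.
  have Ea := E a; have Eb := E b.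
  rewrite !in_setD1 !eqxx (AF _ aA) ab /= in Ea.
  rewrite !in_setD1 !eqxx (AF _ bA) eq_sym ab /= in Eb.
  have Ea' : u a = (v a).+1 :> nat by rewrite -[LHS]addn0 Ea addn1.
  have Ez z : z != a -> z != b -> u z = v z :> nat.
    by move=> za zb; have := E z; rewrite !in_setD1 za zb; lia.
  have /forall_inP/(_ (v a)) := ub; rewrite (_ : v a \in room u a); last first.
    rewrite inE; apply/omegaP => y z yz; rewrite !updE.
    have um := omegaP _ uO; have vm := omegaP _ vO.
    case: (y =P a) => [ya|/eqP ya]; case: (z =P a) => [za|/eqP za] //.
    - by subst y; apply: leq_trans (um _ _ yz); rewrite Ea' leqnSn.
    - subst z; have yb : y != b.
        by apply: contraNneq ab => yb; subst y; apply/eqP/esym/anti.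
      by rewrite Ez//; apply: vm.
    - exact: um.
  by move=> /(_ isT); rewrite Ea' ltnn.
(* Equal images would make [u] the map [v] with its value at [a] lowered by one, again against
   [at_bottom v a]. *)
have core0 a (u v : V) : a \in A -> u \in omega T N -> v \in omega T N ->
    at_bottom v a -> raise F u = raise (F :\ a) v -> raise F u \in set0.
  move=> aA uO vO vb e.
  have E z : (u z + (z \in F) = v z + (z \in F :\ a))%N.
    by rewrite -!raiseE; congr (nat_of_ord _); move/ffunP: e; apply.
  have Ea := E a; rewrite in_setD1 eqxx (AF _ aA) /= in Ea.
  have /forall_inP/(_ (u a)) := vb; rewrite (_ : u a \in room v a); last first.
    rewrite inE (_ : upd v a (u a) = u)//; apply/ffunP => z; rewrite updE.
    case: eqP => [->//|/eqP za]; apply/val_inj => /=.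
    by have := E z; rewrite in_setD1 za /= => /addIn ->.
  by move=> /(_ isT); move: Ea; rewrite addn0 addn1 => <-; rewrite ltnn.
have hinj : {in D &, injective h}.
  move=> [a u] [b v]; rewrite !DE /= => /and3P[aA uO ub] /and3P[bA vO vb].
  exact: core.
have -> : (\sum_(a in A) #|[set u in omega T N | at_bottom u a]| = #|D|)%N.
  by rewrite (card_dep_pairs (mem A) (fun a u => (u \in omega T N) && at_bottom u a)).
rewrite -(card_in_imset hinj) -(card_imset (mem (omega T N)) (@raise_inj F)) -cardsUI.
rewrite (_ : _ :&: _ = set0) ?cards0 ?addn0.
  apply: subset_leq_card; apply/subsetP => v; rewrite inE => /orP[]/imsetP[].
    by move=> u uO ->; apply: raise_omega.
  move=> [a u]; rewrite DE /= => /and3P[aA uO _] ->.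
  by apply: raise_omega => // y z; apply: Faup.
apply/eqP; rewrite -subset0; apply/subsetP => w.
rewrite inE => /andP[/imsetP[u uO ->] /imsetP[[a v]]].
rewrite DE /= => /and3P[aA vO vb].
exact: core0.
Qed.

End OrderPolynomial.

(** * Rooms and heights *)

Section HeightRoom.
Variables (d : Order.disp_t) (T : finPOrderType d) (N : nat) (x : T).
Local Notation V := {ffun T -> 'I_N.+1}.
Implicit Types (u : V) (c : 'I_N.+1) (z : T).

(* For c <= u x, the gap of u on the down-set of x just below c is moved to
   the top: the elements z < x with c <= u z are lowered by its length. *)
Definition below u c : {set T} := [set z | (z <= x)%O && (u z < c)%N].
Definition gap_start u c : nat := \max_(z in below u c) (u z).+1.
Definition gap u c : nat := (c - gap_start u c)%N.
Definition lower u c : V :=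
  [ffun z => if (z < x)%O && (c <= u z)%N then inord (u z - gap u c) else u z].

Lemma gap_start_le u c : (gap_start u c <= c)%N.
Proof. by apply/bigmax_leqP => z; rewrite inE => /andP[]. Qed.

Lemma lowerE u c z : lower u c z =
  (if (z < x)%O && (c <= u z)%N then u z - gap u c else u z)%N :> nat.
Proof.
by rewrite ffunE; case: ifP => // _; rewrite inordK//; have := leN u z; lia.
Qed.

Lemma lower_x u c : lower u c x = u x.
Proof. by rewrite ffunE ltxx. Qed.

Lemma below_gap_start u c z : (z <= x)%O -> (u z < c)%N -> (u z < gap_start u c)%N.
Proof.
move=> zx uc; rewrite /gap_start (bigD1 z) ?inE ?zx ?uc//=.
exact: leq_maxl.
Qed.

(** Lowering stops at [gap_start], so [below u c] can be read off from [lower u c] and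
    [gap_start u c]; this makes the operation invertible. *)
Lemma below_lower u c : (c <= u x)%N ->
  below u c = [set z | (z <= x)%O && (lower u c z < gap_start u c)%N].
Proof.
move=> cx; apply/setP => z; rewrite !inE lowerE; case: (boolP (z <= x)%O) => //= zx.
have := gap_start_le u c; have := @below_gap_start u c z zx; rewrite /gap.
have [uc|uc] := ltnP (u z) c; first by rewrite andbF => ->.
have [->|zx'] := eqVneq z x; first by rewrite ltxx /=; lia.
by rewrite lt_neqAle zx' zx /=; lia.
Qed.

Lemma gap_start_lower u c : (c <= u x)%N ->
  gap_start u c = \max_(z in below u c) (lower u c z).+1.
Proof.
move=> cx; apply: eq_bigr => z; rewrite inE lowerE => /andP[_ uc].
by rewrite leqNgt uc andbF.
Qed.

Lemma lowerK u c z : (c <= u x)%N -> u z =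
  (if (z < x)%O && (gap_start u c <= lower u c z) then lower u c z + gap u c
   else lower u c z)%N :> nat.
Proof.
move=> cx; case: (boolP (z < x)%O) => /= zx; last by rewrite lowerE (negbTE zx).
have /setP/(_ z) := below_lower cx; rewrite !inE (ltW zx) /= => e.
rewrite leqNgt -e lowerE zx /= -leqNgt; case: leqP => // cu.
by rewrite /gap; lia.
Qed.

Lemma lower_omega u c : u \in omega T N -> (c <= u x)%N ->
  lower u c \in omega T N.
Proof.
move=> /omegaP um cx; apply/omegaP => y z yz.
have := um _ _ yz; rewrite !lowerE.
have [zx|zx] := boolP (z < x)%O; last by rewrite /=; case: ifP => _; lia.
have yx : (y < x)%O by apply: le_lt_trans zx.
rewrite yx /=; have := @below_gap_start u c y (ltW yx).
by have := gap_start_le u c; rewrite /gap; case: ifP; case: ifP; lia.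
Qed.

Lemma lower_room u c : u \in omega T N -> (c <= u x)%N ->
  inord (u x - gap u c) \in room (lower u c) x.
Proof.
move=> uO cx; have um := omegaP _ uO; rewrite inE.
have lm := omegaP _ (lower_omega uO cx).
have cE : (inord (u x - gap u c) : 'I_N.+1) = (u x - gap u c)%N :> nat.
  by rewrite inordK//; have := leN u x; lia.
apply/omegaP => y z yz; rewrite !updE.
case: (y =P x) => [yx|/eqP yx]; case: (z =P x) => [zx|/eqP zx] //.
- subst y; rewrite cE; apply: leq_trans (lm _ _ yz); rewrite lower_x.
  exact: leq_subr.
- subst z; have yx' : (y < x)%O by rewrite lt_neqAle yx.
  rewrite cE lowerE yx' /=; have := um _ _ yz; have := @below_gap_start u c y yz.
  by have := gap_start_le u c; rewrite /gap; case: ifP; lia.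
- exact: lm.
Qed.

Lemma card_below u c : (c <= u x)%N -> (#|below u c| < down_card x)%N.
Proof.
move=> cx; apply: proper_card; apply/properP; split.
  by apply/subsetP => z; rewrite !inE => /andP[].
by exists x; rewrite !inE lexx //= -leqNgt.
Qed.

(** For one lowered map, the sets [below] are cut out by thresholds, hence nested; equal cardinals
    make them equal, and they determine [gap_start]. *)
Lemma gap_start_inj u c (v : V) (e : 'I_N.+1) : (c <= u x)%N -> (e <= v x)%N ->
  lower u c = lower v e -> #|below u c| = #|below v e| ->
  gap_start u c = gap_start v e.
Proof.
move=> cx ex luv; wlog le : u v c e cx ex luv / (gap_start u c <= gap_start v e)%N.
  move=> W E; case: (leqP (gap_start u c) (gap_start v e)) => h; first exact: W.
  by apply/esym; apply: W; rewrite // ltnW.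
move=> E; have sub : below u c \subset below v e.
  rewrite (below_lower cx) (below_lower ex); apply/subsetP => z.
  by rewrite !inE luv => /andP[-> /= h]; apply: leq_trans le.
have /eqP bE : below u c == below v e by rewrite eqEcard sub E leqnn.
by rewrite (gap_start_lower cx) (gap_start_lower ex) bE luv.
Qed.

(** The cardinal and the lowered map give [gap_start]; the value of [x] is unchanged by lowering, so
    the third datum gives [gap], and [c] is their sum. *)
Lemma lower_inj u c (v : V) (e : 'I_N.+1) : (c <= u x)%N -> (e <= v x)%N ->
  #|below u c| = #|below v e| -> lower u c = lower v e ->
  inord (u x - gap u c) = inord (v x - gap v e) :> 'I_N.+1 -> (u, c) = (v, e).
Proof.
move=> cx ex E1 luv /(congr1 val) E2.
have lx : u x = v x by rewrite -(lower_x u c) -(lower_x v e) luv.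
have pE := gap_start_inj cx ex luv E1.
have gE : gap u c = gap v e.
  move: E2; rewrite /= !inordK; try (by have := leN u x; have := leN v x; lia).
  move: cx; rewrite lx /gap.
  by have := gap_start_le u c; have := gap_start_le v e; lia.
have ce : c = e.
  apply/val_inj => /=; move: gE pE; rewrite /gap.
  by have := gap_start_le u c; have := gap_start_le v e; lia.
congr pair => //; apply/ffunP => z; apply/val_inj => /=.
by rewrite (lowerK z cx) (lowerK z ex) pE gE luv.
Qed.

(** A pair ([u], [c]) with [c <= u x] is encoded by the lowered map, a point in its room at [x], and
    [#|below u c|], which takes at most [down_card x] values since [x] itself is not below [c]. *)
Lemma sum_height_le_room :
  (\sum_(u in omega T N) (u x).+1 <=
   down_card x * \sum_(u in omega T N) #|room u x|)%N.
Proof.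
have a0 : (0 < down_card x)%N by apply/card_gt0P; exists x; rewrite inE lexx.
pose D := [set p : V * 'I_N.+1 | (p.1 \in omega T N) && (p.2 <= p.1 x)%N].
pose J := 'I_((down_card x).-1.+1).
pose E := [set p : V * 'I_N.+1 | (p.1 \in omega T N) && (p.2 \in room p.1 x)].
have -> : (\sum_(u in omega T N) (u x).+1)%N = #|D|.
  rewrite /D (card_dep_pairs (mem (omega T N)) (fun u c => (c <= u x)%N));
  apply: eq_bigr => u _.
  rewrite -[LHS](card_ord_lt (ltn_ord (u x))).
  by apply: eq_card => c; rewrite !inE ltnS.
have -> : (\sum_(u in omega T N) #|room u x|)%N = #|E|.
  rewrite /E (card_dep_pairs (mem (omega T N)) (fun u c => c \in room u x));
  apply: eq_bigr => u _.
  by apply: eq_card => c; rewrite [in RHS]inE.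
pose h (p : V * 'I_N.+1) : J * (V * 'I_N.+1) :=
  (inord #|below p.1 p.2|, (lower p.1 p.2, inord (p.1 x - gap p.1 p.2))).
have hinj : {in D &, injective h}.
  move=> [u c] [v e]; rewrite !inE /= => /andP[uO cx] /andP[vO ex].
  move=> [/(congr1 val) E1 luv E2].
  rewrite /= !inordK ?prednK ?card_below// in E1.
  exact: lower_inj.
rewrite -(card_in_imset hinj).
apply: (@leq_trans #|setX [set: J] E|); last by rewrite cardsX cardsT card_ord prednK.
apply: subset_leq_card; apply/subsetP => _ /imsetP[[u c] + ->].
rewrite inE /= => /andP[uO cx].
rewrite in_setX in_setT /= inE /= lower_room ?lower_omega//.
Qed.

End HeightRoom.

(** * Linear extensions and injective order-preserving maps *)

Section IncreasingTuples.
Variable (M : nat).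

Definition inctuples m : {set m.-tuple 'I_M} :=
  [set t : m.-tuple 'I_M | sorted ltn (map val t)].

Lemma card_inctuples m : #|inctuples m| = 'C(M, m).
Proof. exact: card_ltn_sorted_tuples. Qed.

Lemma inctuplesP m (t : m.-tuple 'I_M) :
  reflect (forall i j : 'I_m, (i < j)%N -> (tnth t i < tnth t j)%N) (t \in inctuples m).
Proof.
rewrite inE; have sz : size (map val t) = m by rewrite size_map size_tuple.
have nthE (i : 'I_m) : nth 0%N (map val t) i = tnth t i.
  by rewrite (nth_map (tnth t i)) ?size_tuple// -tnth_nth.
apply: (iffP idP) => [st i j ij|H].
  rewrite -!nthE; apply: (sorted_ltn_nth ltn_trans) => //; rewrite inE sz; exact: ltn_ord.
apply/(sortedP 0%N) => i; rewrite sz => im.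
have im' : (i < m)%N by exact: ltn_trans im.
by have := H (Ordinal im') (Ordinal im) (ltnSn _); rewrite -!nthE.
Qed.

Lemma inctuples_lt m (t : m.-tuple 'I_M) (i j : 'I_m) : t \in inctuples m ->
  (tnth t i < tnth t j)%N = (i < j)%N.
Proof.
move=> /inctuplesP tm; case: (ltngtP i j) => [/tm//|/tm h|/val_inj->].
  by apply/negbTE; rewrite -leqNgt ltnW.
by rewrite ltnn.
Qed.

(** Deleting entry number [k <= i] from an increasing [m.+1]-tuple leaves an increasing [m]-tuple
    and a value smaller than its entry [i]; [k] is recovered as the rank of the deleted value. *)
Lemma sum_inctuples_ge m (i : 'I_m) :
  (i.+1 * 'C(M, m.+1) <= \sum_(t in inctuples m) tnth t i)%N.
Proof.
pose K := [set k : 'I_m.+1 | (k < i.+1)%N].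
pose D := setX K (inctuples m.+1).
have -> : (i.+1 * 'C(M, m.+1) = #|D|)%N.
  by rewrite cardsX card_inctuples card_ord_lt// ltnS ltnW.
pose E := [set p : m.-tuple 'I_M * 'I_M | (p.1 \in inctuples m) && (p.2 < tnth p.1 i)%N].
have -> : (\sum_(t in inctuples m) tnth t i = #|E|)%N.
  rewrite (card_dep_pairs (mem (inctuples m)) (fun t (c : 'I_M) => (c < tnth t i)%N)).
  by apply: eq_bigr => t _; rewrite (card_ord_lt (ltnW (ltn_ord (tnth t i)))).
pose h (p : 'I_m.+1 * m.+1.-tuple 'I_M) :=
  ([tuple tnth p.2 (lift p.1 j) | j < m], tnth p.2 p.1).
have lift_lt (k : 'I_m.+1) (j : 'I_m) : (lift k j < k)%N = (j < k)%N.
  by rewrite /= /bump; case: (leqP k j) => h1; lia.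
have rank (k : 'I_m.+1) (t : m.+1.-tuple 'I_M) : t \in inctuples m.+1 ->
    #|[set j : 'I_m | (tnth (h (k, t)).1 j < (h (k, t)).2)%N]| = k.
  move=> tI; rewrite -[RHS](card_ord_lt (ltn_ord k : (k <= m)%N)); apply: eq_card => j.
  by rewrite !inE tnth_mktuple inctuples_lt// lift_lt.
have hinj : {in D &, injective h}.
  move=> [k t] [k' t']; rewrite !in_setX /= => /andP[_ tI] /andP[_ tI'] e.
  have kk : k = k'.
    by apply/val_inj; rewrite /= -[LHS](rank k t tI) -[RHS](rank k' t' tI') e.
  subst k'; congr pair; apply: eq_from_tnth => j.
  have e1 := congr1 fst e; have /= e2 := congr1 snd e.
  case: (unliftP k j) => [l ->|-> //].
  by have := congr1 (fun s : m.-tuple 'I_M => tnth s l) e1; rewrite /= !tnth_mktuple.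
rewrite -(card_in_imset hinj); apply: subset_leq_card.
apply/subsetP => _ /imsetP[[k t] + ->]; rewrite in_setX [k \in K]inE /= => /andP[ki tI].
rewrite inE /=; apply/andP; split.
  apply/inctuplesP => j l jl; rewrite !tnth_mktuple (inctuples_lt _ _ tI)/=.
  by rewrite /bump; case: (leqP k j) => h1; case: (leqP k l) => h2; lia.
by rewrite tnth_mktuple (inctuples_lt _ _ tI)/= /bump; case: (leqP k i) => h1; lia.
Qed.

Lemma expn_le_ffact m k : (k <= m)%N -> ((M - m) ^ k <= M ^_ k)%N.
Proof.
elim: k => [|k IHk] km; first by rewrite expn0 ffactn0.
rewrite expnSr ffactnSr leq_mul ?IHk ?(ltnW km)//.
by rewrite leq_sub2l// ltnW.
Qed.

End IncreasingTuples.

Section LinearExtensions.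
Variables (d : Order.disp_t) (T : finPOrderType d).
Implicit Types (f : {ffun T -> 'I_#|T|}) (x y z : T).

Lemma linextsP f : reflect
  (bijective f /\ forall x y, (x <= y)%O -> (f x <= f y)%N) (f \in linexts T).
Proof. by rewrite inE; apply: (iffP (asboolP _)). Qed.

Lemma linexts_rank f z : f \in linexts T -> #|[set y | (f y < f z)%N]| = f z.
Proof.
move=> /linextsP[fb _]; rewrite -[RHS](card_ord_lt (ltnW (ltn_ord (f z)))).
rewrite -(card_imset _ (bij_inj fb)); apply: eq_card => i; rewrite inE.
have [g gK fK] := fb.
apply/imsetP/idP => [[y] + ->|iz]; first by rewrite inE.
by exists (g i); rewrite ?inE fK.
Qed.

Variable (N : nat).
Local Notation V := {ffun T -> 'I_N.+1}.
Local Notation inc := (inctuples N.+1 #|T|).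

Definition spread f (t : #|T|.-tuple 'I_N.+1) : V := [ffun z => tnth t (f z)].

Lemma spread_lt f t x y : t \in inc -> (spread f t x < spread f t y)%N = (f x < f y)%N.
Proof. by move=> tI; rewrite !ffunE inctuples_lt. Qed.

Lemma spread_omega f t : f \in linexts T -> t \in inc -> spread f t \in omega T N.
Proof.
move=> /linextsP[_ fm] tI; apply/omegaP => x y xy.
by rewrite leqNgt spread_lt// -leqNgt fm.
Qed.

Lemma spread_inj f f' t t' : f \in linexts T -> f' \in linexts T ->
  t \in inc -> t' \in inc -> spread f t = spread f' t' -> f = f' /\ t = t'.
Proof.
move=> fL fL' tI tI' e.
have ff : f = f'.
  apply/ffunP => z; apply/val_inj; rewrite /= -(linexts_rank z fL) -(linexts_rank z fL').
  by apply: eq_card => y; rewrite !inE -(spread_lt f y z tI) -(spread_lt f' y z tI') e.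
subst f'; split=> //; apply: eq_from_tnth => i.
have /linextsP[[g gK fK] _] := fL.
by have /ffunP/(_ (g i)) := e; rewrite !ffunE fK.
Qed.

Lemma spread_surj (u : V) : u \in omega T N -> injective u ->
  exists f t, [/\ f \in linexts T, t \in inc & u = spread f t].
Proof.
move=> /omegaP um ui.
pose r z := #|[set y | (u y < u z)%N]|.
have rT z : (r z < #|T|)%N.
  rewrite -cardsT; apply: proper_card; apply/properP; split; first exact: subsetT.
  by exists z; rewrite ?inE ?ltnn.
have rle y z : (u y <= u z)%N -> (r y <= r z)%N.
  move=> uyz; apply: subset_leq_card; apply/subsetP => w; rewrite !inE => /leq_trans; exact.
have rlt y z : (u y < u z)%N -> (r y < r z)%N.
  move=> uyz; apply: proper_card; apply/properP; split.
    by apply/subsetP => w; rewrite !inE => /ltn_trans; apply.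
  by exists y; rewrite inE ?ltnn.
pose f : {ffun T -> 'I_#|T|} := [ffun z => Ordinal (rT z)].
have fE z : f z = r z :> nat by rewrite ffunE.
have finj : injective f.
  move=> y z /(congr1 val); rewrite /= !fE => ryz; apply: ui; apply/val_inj => /=.
  by case: (ltngtP (u y) (u z)) => [/rlt|/rlt|//]; rewrite ryz ltnn.
have fb : bijective f by apply: inj_card_bij => //; rewrite card_ord.
have [g gK fK] := fb.
exists f, [tuple u (g i) | i < #|T|]; split.
- by apply/linextsP; split => // x y /um/rle; rewrite !fE.
- apply/inctuplesP => i j; rewrite !tnth_mktuple -{1}(fK i) -{1}(fK j) !fE => ij.
  by rewrite ltnNge; apply/negP => /rle; rewrite leqNgt ij.
- by apply/ffunP => z; rewrite [RHS]ffunE tnth_mktuple gK.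
Qed.

Let spreads (F : {set {ffun T -> 'I_#|T|}}) : {set V} :=
  [set spread p.1 p.2 | p in setX F inc].

Let card_spreads (F : {set {ffun T -> 'I_#|T|}}) : F \subset linexts T ->
  #|spreads F| = (#|F| * 'C(N.+1, #|T|))%N.
Proof.
move=> FL; rewrite card_in_imset ?cardsX ?card_inctuples//.
move=> [f t] [f' t']; rewrite !in_setX /= => /andP[fF tI] /andP[fF' tI'] e.
by have [-> ->] := spread_inj (fintype.subsetP FL _ fF) (fintype.subsetP FL _ fF') tI tI' e.
Qed.

Lemma card_linexts_omega : (nlinexts T * 'C(N.+1, #|T|) <= #|omega T N|)%N.
Proof.
rewrite -card_spreads//; apply: subset_leq_card.
apply/subsetP => _ /imsetP[[f t] + ->]; rewrite in_setX => /andP[fL tI].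
exact: spread_omega.
Qed.

Definition noninj : {set V} := [set u in omega T N | ~~ injectiveb u].

(** Choose two points with the same value and overwrite the first one by an arbitrary [c]: the
    second point remembers the erased value. *)
Lemma card_noninj : (#|noninj| * N.+1 <= #|T| ^ 2 * N.+1 ^ #|T|)%N.
Proof.
pose p (u : V) : option (T * T) := [pick p | (p.1 != p.2) && (u p.1 == u p.2)].
have pP (u : V) : u \in noninj -> exists q, [/\ p u = Some q, q.1 != q.2 & u q.1 = u q.2].
  rewrite inE => /andP[_ /injectivePn[x [y xy uxy]]].
  rewrite /p; case: pickP => [q /andP[qn /eqP qu]|/(_ (x, y))]; first by exists q.
  by rewrite /= xy uxy eqxx.
have [T0|/card_gt0P[x0 _]] := posnP #|T|.
  rewrite [#|noninj|]eq_card0// => u; apply/negP => /pP[[x y] _].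
  by have := fintype0 x T0.
pose h (q : V * 'I_N.+1) :=
  (odflt (x0, x0) (p q.1), upd q.1 (odflt (x0, x0) (p q.1)).1 q.2).
have -> : (#|noninj| * N.+1 = #|setX noninj [set: 'I_N.+1]|)%N.
  by rewrite cardsX cardsT card_ord.
have hinj : {in setX noninj [set: 'I_N.+1] &, injective h}.
  move=> [u c] [v e]; rewrite !in_setX /=.
  move=> /andP[/pP[q [pu qn qu]] _] /andP[/pP[q' [pv qn' qv]] _].
  rewrite /h /= pu pv /= => -[qq uv]; subst q'.
  congr pair; last by rewrite -(upd_same u q.1 c) uv upd_same.
  apply/ffunP => z; have /ffunP uv' := uv.
  have := uv' q.2; rewrite !updE eq_sym (negbTE qn) => h2.
  have := uv' z; rewrite !updE; case: eqP => [-> _|//].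
  by rewrite qu qv h2.
rewrite -(card_in_imset hinj).
apply: leq_trans (max_card _) _.
by rewrite card_prod card_prod card_ffun card_ord mulnn.
Qed.

Lemma card_le_linexts x y : x != y ->
  (#|[set u in omega T N | (u x <= u y)%N]| <=
   #|[set f in linexts T | (label f x < label f y)%N]| * 'C(N.+1, #|T|) + #|noninj|)%N.
Proof.
move=> xy; set F := [set f in linexts T | _].
have FL : F \subset linexts T by apply/subsetP => f; rewrite inE => /andP[].
rewrite -card_spreads//; apply: leq_trans (leq_card_setU _ _).1.
apply: subset_leq_card; apply/subsetP => u; rewrite inE => /andP[uO uxy].
rewrite in_setU; case: (boolP (injectiveb u)) => ui; last first.
  by rewrite [X in _ || X]inE uO ui orbT.
apply/orP; left; have [f [t [fL tI uE]]] := spread_surj uO (injectiveP _ ui).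
apply/imsetP; exists (f, t) => //; rewrite in_setX tI andbT inE fL /= /label ltnS.
rewrite -(spread_lt f x y tI) -uE ltn_neqAle uxy andbT.
by apply: contra_neq xy => /val_inj/(injectiveP _ ui).
Qed.

(** Only spreads are kept in the sum; for them [u x] is the tuple entry of index [f x], so the bound
    on entries gives the factor [(f x).+1 = label f x]. *)
Lemma sum_omega_ge x :
  (\sum_(f in linexts T) label f x * 'C(N.+1, #|T|.+1) <= \sum_(u in omega T N) u x)%N.
Proof.
apply: (@leq_trans (\sum_(u in spreads (linexts T)) u x)).
  rewrite big_imset /=; last first.
    move=> [f t] [f' t']; rewrite !in_setX /= => /andP[fL tI] /andP[fL' tI'] e.
    by have [-> ->] := spread_inj fL fL' tI tI' e.
  rewrite (eq_bigl (fun p => (p.1 \in linexts T) && (p.2 \in inc))); last first.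
    by case=> f t; rewrite in_setX.
  rewrite -(pair_big_dep (mem (linexts T)) (fun _ t => t \in inc)
    (fun f t => nat_of_ord (spread f t x)))/=.
  apply: leq_sum => f fL; apply: leq_trans (sum_inctuples_ge N.+1 (f x)) _.
  by apply: leq_sum => t _; rewrite ffunE.
rewrite [leqLHS]big_mkcond [leqRHS]big_mkcond /=; apply: leq_sum => u _.
case: ifP => // /imsetP[[f t]]; rewrite in_setX => /andP[fL tI] ->.
by rewrite (spread_omega fL tI).
Qed.

End LinearExtensions.

(** Sorting by the size of down-sets, with ties broken by the enumeration, is injective and
    order-preserving; its ranks form a linear extension. *)
Lemma nlinexts_gt0 (d : Order.disp_t) (T : finPOrderType d) : (0 < nlinexts T)%N.
Proof.
pose g (z : T) := (down_card z * #|T| + enum_rank z)%N.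
pose M := (\max_z g z)%N.
pose u : {ffun T -> 'I_M.+1} := [ffun z => inord (g z)].
have uE z : u z = g z :> nat by rewrite ffunE inordK// ltnS /M (bigD1 z)//= leq_maxl.
have uO : u \in omega T M.
  apply/omegaP => x y; rewrite !uE le_eqVlt => /orP[/eqP->//|xy].
  have h : (down_card x < down_card y)%N.
    apply: proper_card; apply/properP; split.
      by apply/subsetP => z; rewrite !inE => /le_trans; apply; apply: ltW.
    by exists y; rewrite !inE ?lexx// (lt_geF xy).
  apply: leq_trans (leq_addr _ _); apply: leq_trans (leq_mul h (leqnn #|T|)).
  by rewrite /g mulSn addnC leq_add2r ltnW// ltn_ord.
have ui : injective u.
  move=> x y /(congr1 val); rewrite /= !uE /g => e; apply: enum_rank_inj; apply/val_inj.
  have := congr1 (modn^~ #|T|) e.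
  by rewrite !modnMDl !modn_small ?ltn_ord.
have [f [t [fL _ _]]] := spread_surj uO ui.
by apply/card_gt0P; exists f.
Qed.

Section NonInjective.
Variables (d : Order.disp_t) (T : finPOrderType d) (N : nat).

Lemma card_omega_ge : ((N.+1 - #|T|) ^ #|T| <= (#|T|)`! * #|omega T N|)%N.
Proof.
apply: leq_trans (expn_le_ffact N.+1 (leqnn #|T|)) _.
rewrite -bin_ffact mulnC leq_mul2l; apply/orP; right.
by apply: leq_trans (card_linexts_omega T N); rewrite leq_pmull ?nlinexts_gt0.
Qed.

(** For fixed n, non-injective maps are a fraction O(1 / N) of [omega T N]. *)
Lemma card_noninj_le : (#|T|.*2 <= N.+1)%N ->
  (#|noninj T N| * N.+1 <= #|T| ^ 2 * 2 ^ #|T| * (#|T|)`! * #|omega T N|)%N.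
Proof.
move=> nN; apply: leq_trans (card_noninj T N) _.
rewrite -[leqRHS]mulnA -[leqRHS]mulnA leq_mul2l; apply/orP; right.
apply: (@leq_trans (2 ^ #|T| * (N.+1 - #|T|) ^ #|T|)).
  rewrite -expnMn; have [->|T0] := posnP #|T|; first by rewrite !expn0.
  by rewrite leq_exp2r//; lia.
by rewrite leq_mul2l card_omega_ge orbT.
Qed.

End NonInjective.

(** * Short paths in unbalanced posets *)

Section PathSums.
Variables (V : nmodType) (A : Type).

Fixpoint pathsum (g : A -> A -> V) x s : V :=
  if s is y :: s' then g x y + pathsum g y s' else 0.

Lemma sum_pathsum (I : Type) (r : seq I) (P : pred I) (g : I -> A -> A -> V) x s :
  \sum_(i <- r | P i) pathsum (g i) x s =
  pathsum (fun a b => \sum_(i <- r | P i) g i a b) x s.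
Proof.
elim: s x => [|y s IHs] x /=; first by rewrite big1.
by rewrite big_split/= IHs.
Qed.

End PathSums.

Section SortedPaths.
Variables (R : realFieldType) (A : eqType) (G : A -> A -> R).

(** Along a path sorted by [S], the absolute values disappear and the bounds telescope. *)
Lemma pathsum_sorted_le (S : A -> R) (K : R) x s :
  (forall a b, a != b -> G a b <= K * `|S a - S b|) ->
  path (fun a b => S a <= S b) x s -> uniq (x :: s) ->
  pathsum G x s <= K * (S (last x s) - S x).
Proof.
move=> GS; elim: s x => [|y s IHs] x /=; first by rewrite subrr mulr0.
move=> /andP[Sxy ps] /andP[xs us]; have := IHs y ps us.
have xy : x != y by apply: contraNneq xs => ->; rewrite mem_head.
have := GS _ _ xy; rewrite distrC ger0_norm ?subr_ge0//.
by rewrite !mulrBr; lra.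
Qed.

(** Each vertex is charged to an edge of the path containing it, and no edge is charged more than
    twice. *)
Lemma sum_le_pathsum (L : A -> R) x y s :
  (forall a, 0 <= L a) ->
  (forall a b, a != b -> L a <= G a b) -> (forall a b, a != b -> L b <= G a b) ->
  uniq [:: x, y & s] ->
  \sum_(z <- [:: x, y & s]) L z <= 2 * pathsum G x (y :: s).
Proof.
move=> L0 La Lb; elim: s x y => [|z s IHs] x y /andP[xs us].
  have xy : x != y by apply: contraNneq xs => ->; rewrite mem_head.
  rewrite big_cons big_seq1 /= addr0; have := La _ _ xy; have := Lb _ _ xy; lra.
have xy : x != y by apply: contraNneq xs => ->; rewrite mem_head.
rewrite big_cons; have := IHs y z us; have := La _ _ xy; have := L0 x.
rewrite /=; lra.
Qed.

End SortedPaths.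

Section Deviation.
Variables (R : realType) (d : Order.disp_t) (T : finPOrderType d) (N' : nat).
Local Notation N := N'.+1.
Local Notation V := {ffun T -> 'I_N.+1}.
Local Notation W := (#|omega T N|%:R : R).
Implicit Types (x y z : T) (u : V).

Lemma omega_gt0 : (0 < #|omega T N|)%N.
Proof.
apply/card_gt0P; exists [ffun=> ord0]; apply/omegaP => x y _.
by rewrite !ffunE.
Qed.

(** The variable [u x - u y] is shifted by [N] to be a natural number. The centre [c.+1] of the
    Grünbaum inequality is then [N], hence the form [N'.+1]. *)
Lemma pair_deviation x y (eta : R) : 0 < eta ->
  #|[set u in omega T N | (u x <= u y)%N]|%:R < expR (- 1 - eta) * W ->
  \sum_(u in omega T N) `|(u x)%:R - (u y)%:R| <=
    (1 + 2 / eta) * (\sum_(u in omega T N) (u x)%:R - \sum_(u in omega T N) (u y)%:R) :> R.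
Proof.
move=> eta0 small; pose D u := (u x + N - u y)%N.
have FE k : #|level_le (omega T N) D k| = cumul N x y k.
  by apply: eq_card => u; rewrite !inE /D leq_subLR.
have DE u : (D u)%:R - N%:R = (u x)%:R - (u y)%:R :> R.
  rewrite /D natrB ?natrD; last by have := leN u y; lia.
  by lra.
rewrite -sumrB -(eq_bigr _ (fun u _ => DE u)).
rewrite (eq_bigr (fun u => `|(D u)%:R - N%:R|)); last by move=> u _; rewrite DE.
apply: (@grunbaum_abs R _ (omega T N) D N' (N + N)) => //.
- by move=> i j ij; rewrite !FE; apply: cumul_log_concave.
- by move=> u _; rewrite /D; have := leN u x; lia.
- apply: le_lt_trans small; rewrite FE ler_nat /cumul.
  by apply: subset_leq_card; apply/subsetP => u; rewrite !inE leq_add2r.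
Qed.

Lemma balance_pair_le x y : x != y -> balance_pair R x y <= balance R T.
Proof.
by move=> xy; rewrite /balance; apply: (le_bigmax_cond _ (j := (x, y))).
Qed.

Lemma prob_lt_omega x y : x != y ->
  #|[set u in omega T N | (u x <= u y)%N]|%:R <= prob_lt R x y * W + #|noninj T N|%:R.
Proof.
move=> xy; apply: (@le_trans _ _ (_ * _ + _)%N%:R).
  by rewrite ler_nat; exact: card_le_linexts.
rewrite natrD lerD2r natrM /prob_lt mulrAC ler_pdivlMr ?ltr0n ?nlinexts_gt0//.
rewrite -mulrA ler_wpM2l// mulrC -natrM ler_nat.
exact: card_linexts_omega.
Qed.

Variables (eta : R).
Hypothesis eta0 : 0 < eta.
Hypothesis unbalanced : balance R T < expR (- 1 - eta).
Hypothesis few_noninj :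
  #|noninj T N|%:R <= (expR (- 1 - eta / 2) - expR (- 1 - eta)) * W.
(** The Grünbaum constant for [eta / 2]: the other half of [eta] absorbs the non-injective maps. *)
Let K := 1 + 4 / eta.
Let S z : R := \sum_(u in omega T N) (u z)%:R.

Lemma deviation_le x y : x != y ->
  \sum_(u in omega T N) `|(u x)%:R - (u y)%:R| <= K * `|S x - S y|.
Proof.
move=> xy; wlog small : x y xy / prob_lt R x y < expR (- 1 - eta).
  move=> H; have := le_lt_trans (balance_pair_le xy) unbalanced.
  rewrite /balance_pair minEle; case: ifP => _ h; first exact: H.
  under eq_bigr do rewrite distrC.
  by rewrite distrC; apply: H; rewrite // eq_sym.
have W0 : 0 < W by rewrite ltr0n omega_gt0.
have K2 : K = 1 + 2 / (eta / 2) by rewrite /K; field; rewrite gt_eqF.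
have e2 : 0 < eta / 2 by rewrite divr_gt0.
apply: le_trans (pair_deviation e2 _) _; last first.
  rewrite -K2 ler_wpM2l ?ler_norm// /K addr_ge0// divr_ge0// ltW//.
apply: le_lt_trans (prob_lt_omega xy) _.
have : prob_lt R x y * W < expR (- 1 - eta) * W by rewrite ltr_pM2r.
by move: few_noninj; rewrite mulrBl; lra.
Qed.

Lemma exists_short_path : (1 < #|T|)%N -> exists x y s,
  [/\ uniq [:: x, y & s], (forall z, z \in [:: x, y & s]) &
  \sum_(u in omega T N)
     pathsum (fun a b => `|(u a)%:R - (u b)%:R|) x (y :: s) <= K * N%:R * W].
Proof.
move=> T1; pose r := sort (fun a b => S a <= S b) (enum T).
have ru : uniq r by rewrite sort_uniq enum_uniq.
have rT z : z \in r by rewrite mem_sort mem_enum.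
have rs : sorted (fun a b => S a <= S b) r by apply: sort_sorted => a b; apply: le_total.
have : size r = #|T| by rewrite size_sort cardE.
case E : r T1 => [|x [|y s]] T1; try by move=> h; rewrite -h in T1.
move=> _; rewrite E in ru rT rs.
exists x, y, s; split=> //; rewrite sum_pathsum.
apply: le_trans (pathsum_sorted_le deviation_le rs ru) _.
rewrite -mulrA ler_wpM2l//.
  by rewrite /K addr_ge0// divr_ge0// ltW.
apply: (@le_trans _ _ (S (last x (y :: s)))).
  by rewrite gerBl sumr_ge0.
rewrite -sum1_card natr_sum mulr_sumr; apply: ler_sum => u _.
by rewrite mulr1 ler_nat leN.
Qed.

(** Each edge of the short path dominates a quarter of the room, less one, at either end. The
    constant 8 is 4 times the 2 of the charging argument. *)
Lemma sum_room_le : (1 < #|T|)%N ->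
  \sum_x \sum_(u in omega T N) #|room u x|%:R <= (8 * K * N%:R + #|T|%:R) * W.
Proof.
move=> T1; have [x [y [s [us sT]]]] := exists_short_path T1.
rewrite sum_pathsum => short.
pose L z : R := \sum_(u in omega T N) (#|room u z|%:R - 1) / 4.
have := @sum_le_pathsum R T _ L x y s.
have L0 z : 0 <= L z.
  by apply: sumr_ge0 => u uO; rewrite divr_ge0// subr_ge0 ler1n card_room_gt0.
move=> /(_ (fun a b => \sum_(u in omega T N) `|(u a)%:R - (u b)%:R|) L0).
move=> /(_ (fun a b ab => sum_dist_room R N ab)).
have Lb a b : a != b -> L b <= \sum_(u in omega T N) `|(u a)%:R - (u b)%:R|.
  rewrite eq_sym => /(sum_dist_room R N).
  by under [X in _ <= X -> _]eq_bigr do rewrite distrC.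
move=> /(_ Lb us) H.
have : \sum_z L z <= 2 * (K * N%:R * W).
  apply: le_trans (le_trans H _); last by rewrite ler_pM2l.
  rewrite le_eqVlt; apply/orP; left; apply/eqP.
  rewrite -big_enum/=; apply: perm_big; apply: uniq_perm => //; first exact: enum_uniq.
  by move=> z; rewrite mem_enum sT.
have -> : \sum_z L z = (\sum_x0 \sum_(u in omega T N) #|room u x0|%:R - #|T|%:R * W) / 4.
  rewrite /L; under eq_bigr do rewrite -mulr_suml sumrB sumr_const.
  by rewrite -mulr_suml sumrB sumr_const mulr_natl.
rewrite ler_pdivrMr// lerBlDr => /le_trans; apply.
by rewrite le_eqVlt; apply/orP; left; apply/eqP; ring.
Qed.

End Deviation.

(** * Counting maps with a short path *)

Lemma sum_geometric_dist (R : realFieldType) (q : R) (M a : nat) : 0 <= q < 1 ->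
  (1 - q) * \sum_(c < M) q ^+ ((a - c) + (c - a)) <= 2.
Proof.
move=> /andP[q0 q1].
(* Closed bounds for the partial sums, before and after the peak at [a], make the induction on [M]
   work. *)
suff : (1 - q) * \sum_(c < M) q ^+ ((a - c) + (c - a)) <=
    if (M <= a)%N then q ^+ (a.+1 - M) else 1 + q - q ^+ (M - a).
  move=> /le_trans; apply; case: ifP => _.
    by apply: le_trans (exprn_ile1 _ q0 (ltW q1)) _; lra.
  by have := exprn_ge0 (M - a) q0; lra.
elim: M => [|M IHM]; first by rewrite big_ord0 mulr0 leq0n exprn_ge0.
rewrite big_ord_recr/= mulrDr; move: IHM.
case: (ltngtP M a) => [h|h|->].
- rewrite (_ : M - a = 0)%N; last by lia.
  rewrite (_ : a.+1 - M = (a - M).+1)%N; last by lia.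
  by rewrite addn0 subSS exprS; lra.
- rewrite (_ : a - M = 0)%N; last by lia.
  rewrite (_ : M.+1 - a = (M - a).+1)%N; last by lia.
  by rewrite add0n exprS; lra.
- by rewrite subnn !subSnn expr0 expr1; lra.
Qed.

Section PathPartitionFunction.
Variables (R : realType) (I : finType) (N : nat) (theta : R).
Hypothesis theta0 : 0 < theta.
Local Notation V := {ffun I -> 'I_N.+1}.
Let q := expR (- theta).
(** The Boltzmann weight of the total variation of [u] along the path. *)
Let weight x s (u : V) : R :=
  expR (- theta * pathsum (fun a b => `|(u a)%:R - (u b)%:R|) x s).

Let q01 : 0 <= q < 1.
Proof. by rewrite expR_ge0 expR_lt1 oppr_lt0. Qed.

Let q1 : 0 < 1 - q. Proof. by case/andP: q01 => _; rewrite subr_gt0. Qed.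

Lemma itersum_factor s (g f : V -> R) u :
  (forall v z c, z \in s -> g (upd v z c) = g v) ->
  itersum s (fun v => g v * f v) u = g u * itersum s f u.
Proof.
elim: s u => [//|x s IHs] u gs /=; rewrite mulr_sumr; apply: eq_bigr => c _.
rewrite IHs ?gs ?mem_head// => v z e zs; apply: gs.
by rewrite inE zs orbT.
Qed.

(** Only the first edge sees the vertex [x], so the weight factors edge by edge; each edge costs a
    two-sided geometric series. *)
Lemma itersum_weight_le x s u : uniq (x :: s) ->
  itersum s (weight x s) u <= (2 / (1 - q)) ^+ size s.
Proof.
elim: s x u => [|y s IHs] x u us.
  by rewrite /= /weight /= mulr0 expR0 expr0.
move: us => /= /andP[xys us]; have xs : x \notin s.
  by apply: contra xys => xs; rewrite inE xs orbT.
have ys : y \notin s by case/andP: us.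
have xy : x != y by apply: contraNneq xys => ->; rewrite mem_head.
pose g (v : V) := expR (- theta * `|(v x)%:R - (v y)%:R|).
have wE : weight x (y :: s) = fun v => g v * weight y s v.
  by apply/funext => v; rewrite /weight /= mulrDr expRD.
rewrite wE; under eq_bigr => c _.
  rewrite itersum_factor; last first.
    move=> v z e zs; rewrite /g !updE.
    have -> : (x == z) = false by apply/eqP => xz; rewrite xz zs in xs.
    have -> // : (y == z) = false by apply/eqP => yz; rewrite yz zs in ys.
  over.
apply: (@le_trans _ _ (\sum_(c < N.+1)
    q ^+ ((u x - c) + (c - u x)) * (2 / (1 - q)) ^+ size s)).
  apply: ler_sum => c _; apply: ler_pM.
  - exact: expR_ge0.
  - rewrite itersumE; last by case/andP: us.
    by apply: sumr_ge0 => v _; apply: expR_ge0.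
  - rewrite /g upd_same updE (negbTE xy) natr_dist /q -expRM_natl.
    by rewrite mulrC.
  - exact: IHs.
rewrite -mulr_suml [leRHS]exprS; apply: ler_wpM2r.
  by rewrite exprn_ge0// divr_ge0// ltW.
by rewrite ler_pdivlMr// mulrC sum_geometric_dist.
Qed.

Lemma sum_weight_le x s : uniq (x :: s) -> (forall z, z \in x :: s) ->
  \sum_u weight x s u <= N.+1%:R * (2 / (1 - q)) ^+ size s.
Proof.
move=> us sT; pose u0 : V := [ffun=> ord0].
have -> : \sum_u weight x s u = itersum (x :: s) (weight x s) u0.
  rewrite itersumE//; apply: eq_bigl => v; apply/esym/forallP => z.
  by rewrite sT.
rewrite /=; apply: (@le_trans _ _ (\sum_(c < N.+1) (2 / (1 - q)) ^+ size s)).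
  by apply: ler_sum => c _; apply: itersum_weight_le.
by rewrite sumr_const card_ord -[leLHS]mulr_natl.
Qed.

(** Jensen's inequality for the exponential, through its tangent at [m]: the partition function is
    at least [#|Om|] times the weight of a path of length [m]. *)
Lemma card_le_of_short_path (Om : {set V}) x s (m : R) :
  uniq (x :: s) -> (forall z, z \in x :: s) ->
  \sum_(u in Om) pathsum (fun a b => `|(u a)%:R - (u b)%:R|) x s <= m * #|Om|%:R ->
  #|Om|%:R * expR (- theta * m) <= N.+1%:R * (2 / (1 - q)) ^+ size s.
Proof.
move=> us sT short; apply: le_trans (sum_weight_le us sT).
apply: (@le_trans _ _ (\sum_(u in Om) weight x s u)); last first.
  rewrite [leLHS]big_mkcond/=; apply: ler_sum => u _.
  by case: ifP => // _; apply: expR_ge0.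
set M := fun u : V => pathsum (fun a b => `|(u a)%:R - (u b)%:R| : R) x s.
have low (u : V) : expR (- theta * m) * (1 + - theta * (M u - m)) <= weight x s u.
  have -> : weight x s u = expR (- theta * (M u - m)) * expR (- theta * m).
    by rewrite -expRD -mulrDr subrK.
  rewrite mulrC.
  by rewrite ler_wpM2r ?expR_ge0// expR_ge1Dx.
apply: (le_trans _ (ler_sum _ (fun u _ => low u))).
rewrite -mulr_sumr mulrC ler_wpM2l ?expR_ge0//.
rewrite big_split/= sumr_const -mulr_sumr sumrB sumr_const.
rewrite lerDl mulNr oppr_ge0 mulr_ge0_le0 ?(ltW theta0)// subr_le0.
by rewrite -mulr_natr.
Qed.

End PathPartitionFunction.

Lemma one_minus_expR_ge (R : realType) (theta : R) : 0 < theta <= 1 ->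
  theta / 2 <= 1 - expR (- theta).
Proof.
move=> /andP[t0 t1]; have h : 1 + theta <= expR theta by exact: expR_ge1Dx.
have p : 0 < 1 + theta by rewrite addr_gt0.
have : expR (- theta) <= (1 + theta)^-1.
  by rewrite expRN lef_pV2// posrE// expR_gt0.
have : (1 + theta)^-1 <= 1 - theta / 2.
  by rewrite -div1r ler_pdivrMr//; nra.
by lra.
Qed.

(** * Bound on the number of linear extensions *)

Section LinextsBound.
Variables (R : realType) (d : Order.disp_t) (T : finPOrderType d) (N : nat) (K : R).
Local Notation n := #|T|.

(** With theta = n / N, the partition function bounds [#|omega T N|] by e^(K n) (N + 1) (4 (N + 1) /
    n)^(n - 1), while it is at least the number of linear extensions times (N + 1)^n / (2^n n!).
    Powers of N + 1 cancel, and [n! <= n^n] and [n <= 2^n] leave 16^n e^(K n). *)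
Lemma ln_nlinexts_le x s :
  (1 < n)%N -> (n.*2 <= N)%N -> uniq (x :: s) -> (forall z, z \in x :: s) ->
  \sum_(u in omega T N) pathsum (fun a b => `|(u a)%:R - (u b)%:R|) x s <=
    K * N%:R * #|omega T N|%:R ->
  ln (nlinexts T)%:R <= (K + ln 16) * n%:R :> R.
Proof.
move=> n1 nN us sT short.
have n0 : 0 < n%:R :> R by rewrite ltr0n; lia.
have N0 : 0 < N%:R :> R by rewrite ltr0n; lia.
pose theta : R := n%:R / N%:R.
have t0 : 0 < theta by rewrite divr_gt0.
have t1 : theta <= 1 by rewrite ler_pdivrMr// mul1r ler_nat; lia.
have := card_le_of_short_path t0 us sT short.
set W := #|omega T N|%:R.
have -> : - theta * (K * N%:R) = - (K * n%:R).
  by rewrite /theta; field; rewrite gt_eqF.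
have sz : size s = n.-1.
  have : #|x :: s| = n by apply: eq_card => z; rewrite sT.
  by have /card_uniqP -> := us; move=> /= <-.
rewrite sz => Wle.
have Wle2 : W * expR (- (K * n%:R)) <= N.+1%:R * (4 * N.+1%:R / n%:R) ^+ n.-1.
  apply: le_trans Wle _; rewrite ler_wpM2l//; apply: lerXn2r; rewrite ?nnegrE.
  - by rewrite divr_ge0// subr_ge0 expR_le1 oppr_le0 ltW.
  - by rewrite divr_ge0 ?mulr_ge0// ltW.
  have h := one_minus_expR_ge (introT andP (conj t0 t1)).
  apply: (@le_trans _ _ (2 / (theta / 2))).
    rewrite ler_pM2l// lef_pV2// posrE ?divr_gt0//.
    by apply: lt_le_trans h; rewrite divr_gt0.
  have -> : 2 / (theta / 2) = 4 * N%:R / n%:R.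
    by rewrite /theta; field; rewrite !gt_eqF.
  by rewrite ler_pM2r ?invr_gt0// ler_pM2l// ler_nat.
have low : (nlinexts T * N.+1 ^ n <= 2 ^ n * ((n)`! * #|omega T N|))%N.
  apply: (@leq_trans (2 ^ n * (nlinexts T * (N.+1 - n) ^ n))).
    rewrite mulnCA leq_mul2l -expnMn; apply/orP; right.
    by rewrite leq_exp2r ?(ltnW n1)//; lia.
  rewrite leq_mul2l; apply/orP; right.
  apply: leq_trans (leq_mul (leqnn _) (card_linexts_omega T N)).
  rewrite mulnCA leq_mul2l; apply/orP; right.
  by rewrite mulnC bin_ffact; apply: expn_le_ffact.
have fact_le k : (k`! <= k ^ k)%N.
  elim: k => // k IHk; rewrite factS expnS leq_mul2l /=.
  apply: leq_trans IHk _; have [->//|k0] := posnP k.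
  by rewrite leq_exp2r.
pose E := expR (K * n%:R) : R; have E0 : 0 < E by exact: expR_gt0.
pose a := N.+1%:R : R; have a0 : 0 < a by rewrite ltr0n.
have Wle3 : W <= E * (a * (4 * a / n%:R) ^+ n.-1).
  move: Wle2; rewrite expRN -/E ler_pdivrMr// => /le_trans; apply.
  by rewrite mulrC.
have nn : n = n.-1.+1 by rewrite prednK// ltnW.
have eE : (nlinexts T)%:R <= 16 ^+ n * E :> R.
  have an : 0 < a ^+ n by rewrite exprn_gt0.
  rewrite -(ler_pM2r an).
  apply: (@le_trans _ _ (2 ^+ n * (n%:R ^+ n * (E * (a * (4 * a / n%:R) ^+ n.-1))))).
    have : (nlinexts T * N.+1 ^ n)%:R <= (2 ^ n * ((n)`! * #|omega T N|))%:R :> R.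
      by rewrite ler_nat.
    rewrite !natrM !natrX -/a -/W => /le_trans; apply.
    rewrite ler_wpM2l ?exprn_ge0//; apply: ler_pM => //.
    by rewrite -natrX ler_nat.
  have n2 : n%:R <= 2 ^+ n :> R by rewrite -natrX ler_nat ltnW// ltn_expl.
  have -> : 2 ^+ n * (n%:R ^+ n * (E * (a * (4 * a / n%:R) ^+ n.-1))) =
      2 ^+ n * 4 ^+ n.-1 * n%:R * E * a ^+ n :> R.
    have id (m : nat) (b : R) : b != 0 ->
        b ^+ m.+1 * (E * (a * (4 * a / b) ^+ m)) = 4 ^+ m * b * E * a ^+ m.+1.
      move=> b0; rewrite !exprMn exprVn !exprS.
      by field; rewrite expf_neq0.
    by have := id n.-1 n%:R (lt0r_neq0 n0); rewrite -nn => ->; ring.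
  rewrite ler_wpM2r ?(ltW an)// ler_wpM2r ?(ltW E0)//.
  have -> : 16 = 2 * 4 * 2 :> R by ring.
  rewrite !exprMn; apply: ler_pM => //; rewrite ?mulr_ge0 ?exprn_ge0//.
  by rewrite ler_wpM2l ?exprn_ge0// ler_eXn2l ?ltr1n// leq_pred.
have e0 : 0 < (nlinexts T)%:R :> R by rewrite ltr0n nlinexts_gt0.
have : ln (nlinexts T)%:R <= ln (16 ^+ n * E) :> R.
  by rewrite ler_ln ?posrE// mulr_gt0// exprn_gt0.
rewrite lnM ?posrE ?exprn_gt0// lnXn// expRK => /le_trans; apply.
have -> : ln (16 : R) *+ n = ln 16 * n%:R by rewrite mulr_natr.
by rewrite [leRHS]mulrDl addrC.
Qed.

End LinextsBound.

(** * Lower bounds for rooms *)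

Section AntichainRooms.
Variables (R : realFieldType) (d : Order.disp_t) (T : finPOrderType d) (N : nat).
Local Notation n := #|T|.
Local Notation W := (#|omega T N|%:R : R).

(** The maps at the bottom of a room at some [a] in [A] are paid for by the growth of [omega] from N
    to N + 1, which [omega_ratio] limits. *)
Lemma sum_inv_room_antichain (A : {set T}) : (n <= N.+2)%N -> antichain A ->
  (N.+2 - n)%:R * (\sum_(a in A) \sum_(u in omega T N) (#|room u a|%:R)^-1) <= n%:R * W.
Proof.
move=> nN Aanti.
set X := (\sum_(a in A) #|[set u in omega T N | at_bottom u a]|)%N.
have XW : ((N.+2 - n) * X <= n * #|omega T N|)%N.
  have := leq_mul (leqnn (N.+2 - n)) (omega_antichain_step N Aanti).
  have := omega_ratio T N; rewrite -/X.
  by move: (#|omega T N|) (#|omega T N.+1|) => w w'; nia.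
apply: (@le_trans _ _ ((N.+2 - n) * X)%:R); last by rewrite -natrM ler_nat.
rewrite natrM ler_wpM2l// natr_sum; apply: ler_sum => a _.
exact: sum_inv_room.
Qed.

(** From harmonic to arithmetic means: a room of size l satisfies l >= 2 t - t^2 / l, summed over
    [A] and [omega T N]. *)
Lemma sum_room_antichain (A : {set T}) : (0 < n <= N.+1)%N -> antichain A ->
  #|A|%:R ^+ 2 * (N.+2 - n)%:R * W <=
  n%:R * \sum_(a in A) \sum_(u in omega T N) #|room u a|%:R.
Proof.
move=> /andP[n0 nN] Aanti.
have nR : 0 < n%:R :> R by rewrite ltr0n.
have := sum_inv_room_antichain (leqW nN) Aanti.
set c := (N.+2 - n)%:R; set J := \sum_(a in A) _ => hJ.
set L := \sum_(a in A) _.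
have c0 : 0 < c by rewrite ltr0n subn_gt0.
(* This [t] turns the bound on inverse rooms into [t ^+ 2 * J <= t * (#|A|%:R * W)], so half of the
   linear term survives. *)
pose t := #|A|%:R * c / n%:R : R.
have LJ : 2 * t * (#|A|%:R * W) - t ^+ 2 * J <= L.
  rewrite /J /L mulr_sumr -mulrA.
  have -> : t * (#|A|%:R * W) = \sum_(a in A) \sum_(u in omega T N) t.
    rewrite (eq_bigr (fun=> t * W)); last by move=> a _; rewrite sumr_const mulr_natr.
    by rewrite sumr_const -mulr_natr; ring.
  rewrite mulr_sumr -sumrB; apply: ler_sum => a _.
  rewrite !mulr_sumr -sumrB; apply: ler_sum => u uO.
  have L0 : 0 < #|room u a|%:R :> R by rewrite ltr0n card_room_gt0.
  move: (#|room u a|%:R) L0 => l l0.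
  have : 0 <= (l - t) ^+ 2 / l by rewrite divr_ge0 ?sqr_ge0// ltW.
  have -> : (l - t) ^+ 2 / l = l - 2 * t + t ^+ 2 / l by field; rewrite gt_eqF.
  by lra.
have tJ : t ^+ 2 * J <= t * (#|A|%:R * W).
  have -> : t ^+ 2 * J = t * #|A|%:R / n%:R * (c * J).
    by rewrite {1}expr2 {2}/t; field; rewrite gt_eqF.
  have -> : t * (#|A|%:R * W) = t * #|A|%:R / n%:R * (n%:R * W).
    by field; rewrite gt_eqF.
  have t0 : 0 <= t by apply: divr_ge0 => //; apply: mulr_ge0 => //; apply: ltW.
  by apply: ler_wpM2l => //; apply: divr_ge0 => //; apply: mulr_ge0.
have -> : #|A|%:R ^+ 2 * c * W = n%:R * (t * (#|A|%:R * W)).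
  by rewrite /t; field; rewrite gt_eqF.
by rewrite ler_pM2l//; lra.
Qed.

End AntichainRooms.

(** * Average heights and mean values of order-preserving maps *)

Section AverageHeights.
Variables (R : realType) (d : Order.disp_t) (T : finPOrderType d) (N : nat).
Local Notation n := #|T|.
Local Notation W := (#|omega T N|%:R : R).

Lemma omega_le_linexts (x y : T) : x != y ->
  (#|omega T N| <= nlinexts T * 'C(N.+1, n) + #|noninj T N|.*2)%N.
Proof.
move=> xy; have yx : y != x by rewrite eq_sym.
pose Fxy := [set f in linexts T | (label f x < label f y)%N].
pose Fyx := [set f in linexts T | (label f y < label f x)%N].
apply: (@leq_trans (#|[set u in omega T N | (u x <= u y)%N]| +
                    #|[set u in omega T N | (u y <= u x)%N]|)).
  apply: leq_trans (leq_card_setU _ _).1; apply: subset_leq_card; apply/subsetP => u uO.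
  by rewrite in_setU ![u \in [set _ in _ | _]]inE uO /=; apply: leq_total.
apply: leq_trans (leq_add (card_le_linexts N xy) (card_le_linexts N yx)) _.
rewrite -/Fxy -/Fyx addnACA -mulnDl addnn leq_add2r leq_mul2r; apply/orP; right.
rewrite -cardsUI (_ : Fxy :&: Fyx = set0) ?cards0 ?addn0.
  apply: subset_leq_card; apply/subsetP => f.
  by rewrite in_setU ![f \in [set _ in _ | _]]inE => /orP[]/andP[].
apply/setP => f; rewrite !in_setI ![f \in [set _ in _ | _]]inE in_set0.
by case: ltngtP; rewrite ?andbF.
Qed.

(** The quotient of the two binomials is (N + 1 - n) / (n + 1). The 8 collects three factors 2, from
    [W <= 2 * (e * C)], N <= 2 (N + 1 - n) and n + 1 <= 2 n. *)
Lemma avg_height_le (x : T) : (1 < n)%N -> (n.*2 <= N)%N ->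
  #|noninj T N|%:R <= W / 4 ->
  avg_height R x * N%:R * W <= 8 * n%:R * \sum_(u in omega T N) (u x)%:R.
Proof.
move=> n1 nN few.
have [y xy] : exists y, x != y.
  have : (0 < #|predC1 x|)%N by rewrite cardC1 -subn1 subn_gt0.
  by move=> /card_gt0P[y]; rewrite !inE eq_sym; exists y.
set S := \sum_(u in omega T N) _.
set e := (nlinexts T)%:R : R; have e0 : 0 < e by rewrite ltr0n nlinexts_gt0.
set C := ('C(N.+1, n))%:R : R.
have eC : W <= 2 * (e * C).
  have : (#|omega T N|)%:R <= (nlinexts T * 'C(N.+1, n) + #|noninj T N|.*2)%:R :> R.
    by rewrite ler_nat; apply: omega_le_linexts xy.
  rewrite natrD natrM -/e -/C -mul2n natrM.
  by lra.
have h0 : 0 <= avg_height R x by rewrite divr_ge0 ?sumr_ge0.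
have hS : avg_height R x * e * ('C(N.+1, n.+1))%:R <= S.
  rewrite /avg_height divfK ?gt_eqF// mulr_suml /S.
  have := sum_omega_ge N x; rewrite -(ler_nat R) !natr_sum; apply: le_trans.
  rewrite le_eqVlt; apply/orP; left; apply/eqP.
  by apply: eq_bigr => f _; rewrite natrM.
have binE : n.+1%:R * ('C(N.+1, n.+1))%:R = (N.+1 - n)%:R * C :> R.
  by rewrite -!natrM mul_bin_left.
have nN2 : N%:R <= 2 * (N.+1 - n)%:R :> R by rewrite -natrM ler_nat; lia.
have nn : n.+1%:R <= 2 * n%:R :> R by rewrite -natrM ler_nat; lia.
have S0 : 0 <= S by apply: sumr_ge0.
apply: (@le_trans _ _ (4 * (n.+1%:R * S))); last first.
  by rewrite -[8 * _]mulrC; nra.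
apply: (@le_trans _ _
  (4 * (n.+1%:R * (avg_height R x * e * ('C(N.+1, n.+1))%:R)))); last first.
  by rewrite ler_pM2l// ler_pM2l.
have -> : 4 * (n.+1%:R * (avg_height R x * e * ('C(N.+1, n.+1))%:R)) =
    avg_height R x * (2 * (N.+1 - n)%:R * (2 * (e * C))).
  have -> : 4 * (n.+1%:R * (avg_height R x * e * ('C(N.+1, n.+1))%:R)) =
    4 * avg_height R x * e * (n.+1%:R * ('C(N.+1, n.+1))%:R) by ring.
  by rewrite binE; ring.
by rewrite -mulrA ler_wpM2l// ler_pM.
Qed.

Lemma avg_height_le_room (x : T) : (1 < n)%N -> (n.*2 <= N)%N ->
  #|noninj T N|%:R <= W / 4 ->
  avg_height R x / (down_card x)%:R * N%:R * W <=
    8 * n%:R * \sum_(u in omega T N) #|room u x|%:R.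
Proof.
move=> n1 nN few.
have a0 : 0 < (down_card x)%:R :> R.
  by rewrite ltr0n; apply/card_gt0P; exists x; rewrite inE lexx.
have -> : avg_height R x / (down_card x)%:R * N%:R * W =
   (avg_height R x * N%:R * W) / (down_card x)%:R by ring.
rewrite ler_pdivrMr//; apply: le_trans (avg_height_le x n1 nN few) _.
rewrite -[leRHS]mulrA ler_wpM2l ?mulr_ge0// -!natr_sum -natrM ler_nat mulnC.
apply: leq_trans (sum_height_le_room N x).
by apply: leq_sum => u _.
Qed.

End AverageHeights.

(** * Room profile of an unbalanced poset *)

Section Levels.
Variables (d : Order.disp_t) (T : finPOrderType d).
Implicit Types (x y : T) (A C : {set T}).

Lemma chainP C : reflect (forall x y, x \in C -> y \in C -> (x >=< y)%O) (chain C).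
Proof.
apply: (iffP forall_inP) => [H x y xC yC|H x xC].
  by have /forall_inP := H x xC; apply.
by apply/forall_inP => y; apply: H.
Qed.

Lemma antichain_set0 : antichain (set0 : {set T}).
Proof. by apply/forall_inP => x; rewrite inE. Qed.

(** Mirsky's rank: the size of a longest chain in the down-set of [x]. *)
Definition level x : nat :=
  (\max_(C : {set T} | chain C && [forall y in C, (y <= x)%O]) #|C|)%N.

Lemma level_le_height x : (level x <= height T)%N.
Proof. by apply/bigmax_leqP => C /andP[cC _]; apply: leq_bigmax_cond. Qed.

Lemma level_lt x y : (x < y)%O -> (level x < level y)%N.
Proof.
move=> xy; pose P C := chain C && [forall z in C, (z <= x)%O].
have P0 : (0 < #|P|)%N.
  apply/card_gt0P; exists set0; apply/andP; split.
    by apply/chainP => a b; rewrite inE.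
  by apply/forall_inP => z; rewrite inE.
have -> : level x = \max_(C in P) #|C| by [].
have [C CP ->] := eq_bigmax_cond (fun C : {set T} => #|C|) P0.
have /andP[/chainP cC /forall_inP Cx] : P C by exact: CP.
have yC : y \notin C.
  by apply/negP => /Cx yx; have := lt_le_trans xy yx; rewrite ltxx.
have -> : #|C|.+1 = #|y |: C| by rewrite cardsU1 yC.
apply: leq_bigmax_cond; apply/andP; split.
  apply/chainP => a b; rewrite !in_setU1 => /predU1P[->|aC] /predU1P[->|bC].
  - exact: comparablexx.
  - by rewrite comparable_sym; apply/le_comparable/(le_trans (Cx _ bC))/ltW.
  - by apply/le_comparable/(le_trans (Cx _ aC))/ltW.
  - exact: cC.
apply/forall_inP => z; rewrite in_setU1 => /predU1P[->//|/Cx zx].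
exact: le_trans zx (ltW xy).
Qed.

Lemma antichain_level i : antichain [set x | level x == i].
Proof.
apply/forall_inP => x; rewrite inE => /eqP xi; apply/forall_inP => y.
rewrite inE => /eqP yi; apply/implyP => /orP[].
  rewrite le_eqVlt => /orP[/eqP->//|/level_lt].
  by rewrite xi yi ltnn.
rewrite le_eqVlt => /orP[/eqP->//|/level_lt].
by rewrite xi yi ltnn.
Qed.

End Levels.

Section RoomProfile.
Variables (R : realType) (d : Order.disp_t) (T : finPOrderType d) (eta : R).
Local Notation n := #|T|.
Local Notation K := (1 + 4 / eta).

(** The profile [l x] is the mean room of [x] divided by N, for one large N; the estimates are
    gathered here in a form free of N. *)
Lemma room_profile : 0 < eta -> (1 < n)%N -> balance R T < expR (- 1 - eta) ->
  exists l : T -> R, [/\ forall x, 0 <= l x, \sum_x l x <= 8 * K + 1,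
    forall A : {set T}, antichain A -> #|A|%:R ^+ 2 <= 2 * n%:R * \sum_(a in A) l a,
    forall x, avg_height R x / (down_card x)%:R <= 8 * n%:R * l x &
    ln (nlinexts T)%:R <= (K + ln 16) * n%:R].
Proof.
move=> eta0 n1 unb.
pose e1 := expR (- 1 - eta / 2) - expR (- 1 - eta) : R.
have e10 : 0 < e1 by rewrite subr_gt0 ltr_expR; lra.
pose eps := Num.min (1 / 4) e1.
have eps0 : 0 < eps by rewrite lt_min e10 divr_gt0.
pose B := (n ^ 2 * 2 ^ n * (n)`!)%N.
(* N is taken so large that non-injective maps form a fraction at most [eps], serving both the
   deviation and the height estimates. *)
have [N' nN BN] : exists2 N', (n.*2 <= N'.+1)%N & B%:R <= eps * N'.+2%:R :> R.
  exists (maxn n.*2 (Num.bound (B%:R / eps))); first by rewrite leqW// leq_maxl.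
  rewrite mulrC -ler_pdivrMr//; apply: ltW.
  apply: lt_le_trans (archi_boundP _) _; first by rewrite divr_ge0// ltW.
  by rewrite ler_nat; apply: leq_trans (leq_maxr n.*2 _) (leqW (leqnSn _)).
set W := #|omega T N'.+1|%:R : R.
have W0 : 0 < W by rewrite ltr0n omega_gt0.
have few : #|noninj T N'.+1|%:R <= eps * W.
  have N0 : 0 < N'.+2%:R :> R by rewrite ltr0n.
  rewrite -(ler_pM2r N0); apply: (@le_trans _ _ (B%:R * W)).
    by rewrite -!natrM ler_nat; apply: card_noninj_le; exact: leqW.
  by rewrite mulrAC ler_pM2r.
have few4 : #|noninj T N'.+1|%:R <= W / 4.
  apply: le_trans few _; rewrite mulrC ler_pM2l//.
  by rewrite -div1r ge_min lexx.
have few1 : #|noninj T N'.+1|%:R <= e1 * W.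
  apply: le_trans few _; rewrite ler_pM2r//.
  by rewrite ge_min lexx orbT.
have n0 : 0 < n%:R :> R by rewrite ltr0n ltnW.
have N0 : 0 < N'.+1%:R :> R by rewrite ltr0n.
have WN : 0 < W * N'.+1%:R by rewrite mulr_gt0.
pose L x : R := \sum_(u in omega T N'.+1) #|room u x|%:R.
exists (fun x => L x / (W * N'.+1%:R)); split.
- by move=> x; rewrite divr_ge0 ?(ltW WN)// sumr_ge0.
- rewrite -mulr_suml ler_pdivrMr//.
  apply: le_trans (sum_room_le eta0 unb few1 n1) _.
  rewrite -/W (_ : (8 * K + 1) * (W * N'.+1%:R) =
    (8 * K * N'.+1%:R + N'.+1%:R) * W); last by ring.
  rewrite ler_pM2r// lerD2l ler_nat.
  by rewrite (leq_trans _ nN)// -addnn leq_addr.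
- move=> A Aanti; rewrite -mulr_suml mulrA ler_pdivlMr//.
  have nN1 : (0 < n <= N'.+2)%N by move: n1 nN; clear; lia.
  have hA := sum_room_antichain R nN1 Aanti; rewrite -/W -/L in hA.
  have N2 : N'.+1%:R <= 2 * (N'.+3 - n)%:R :> R
    by rewrite -natrM ler_nat; move: nN; clear; lia.
  apply: (@le_trans _ _ (2 * (#|A|%:R ^+ 2 * (N'.+3 - n)%:R * W))).
    rewrite (_ : 2 * _ = #|A|%:R ^+ 2 * (W * (2 * (N'.+3 - n)%:R))); last by ring.
    by rewrite ler_wpM2l ?sqr_ge0// ler_pM2l.
  by rewrite -[2 * _ * _]mulrA ler_pM2l.
- move=> x; rewrite mulrA ler_pdivlMr//.
  by have := avg_height_le_room x n1 nN few4; rewrite -/W -/(L x) mulrAC -!mulrA.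
- have [x [y [s [us sT short]]]] := exists_short_path eta0 unb few1 n1.
  exact: ln_nlinexts_le n1 nN us sT short.
Qed.

End RoomProfile.

(** * Bounds for unbalanced posets *)

Section UnbalancedBounds.
Variables (R : realType) (d : Order.disp_t) (T : finPOrderType d) (eta : R).
Local Notation n := #|T|.
Local Notation C := (2 * (8 * (1 + 4 / eta) + 1)).
Hypothesis eta0 : 0 < eta.
Hypothesis n1 : (1 < n)%N.
Hypothesis unbalanced : balance R T < expR (- 1 - eta).

Let n0 : 0 < n%:R :> R. Proof. by rewrite ltr0n ltnW. Qed.

Lemma width_le : (width T)%:R ^+ 2 <= C * n%:R :> R.
Proof.
have [l [l0 lsum lA _ _]] := room_profile eta0 n1 unbalanced.
have P0 : (0 < #|[pred A : {set T} | antichain A]|)%N.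
  by apply/card_gt0P; exists set0; apply: antichain_set0.
have [A AP] := eq_bigmax_cond (fun A : {set T} => #|A|) P0.
rewrite (_ : \max_(i in _) _ = width T)%N// => ->.
apply: le_trans (lA A AP) _; rewrite mulrAC ler_pM2r// ler_pM2l//.
apply: le_trans lsum; rewrite [leLHS]big_mkcond/=.
by apply: ler_sum => x _; case: ifP.
Qed.

Lemma card_le_height : n%:R <= C * (height T).+1%:R :> R.
Proof.
have [l [l0 lsum lA _ _]] := room_profile eta0 n1 unbalanced.
pose h := (height T).+1; have h0 : 0 < h%:R :> R by rewrite ltr0n.
pose A (i : 'I_h) := [set x : T | level x == i].
have sumA (f : T -> R) : \sum_(i < h) \sum_(a in A i) f a = \sum_x f x.
  rewrite [RHS](partition_big (fun x => inord (level x) : 'I_h) predT)//=.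
  apply: eq_bigr => i _; apply: eq_bigl => x; rewrite inE.
  by rewrite -val_eqE /= inordK// ltnS level_le_height.
have cardA : \sum_(i < h) #|A i|%:R = n%:R :> R.
  have := sumA (fun=> 1); rewrite sumr_const => <-.
  by apply: eq_bigr => i _; rewrite sumr_const.
(* Cauchy-Schwarz over the level sets: [t] is their mean size, and expanding (#|A i| - t)^2 >= 0
   bounds the sum of squares below by n^2 / h. *)
pose t := n%:R / h%:R : R.
have low : t * n%:R <= \sum_(i < h) #|A i|%:R ^+ 2.
  have -> : t * n%:R = \sum_(i < h) (2 * t * #|A i|%:R - t ^+ 2).
    rewrite sumrB -mulr_sumr cardA sumr_const card_ord -mulr_natr /t.
    by field; rewrite gt_eqF.
  apply: ler_sum => i _; have := sqr_ge0 (#|A i|%:R - t); rewrite sqrrB; lra.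
have up : \sum_(i < h) #|A i|%:R ^+ 2 <= 2 * n%:R * (8 * (1 + 4 / eta) + 1).
  apply: (@le_trans _ _ (\sum_(i < h) (2 * n%:R * \sum_(a in A i) l a))).
    by apply: ler_sum => i _; apply/lA/antichain_level.
  by rewrite -mulr_sumr sumA ler_pM2l// mulr_gt0.
have : t <= C.
  by rewrite -(ler_pM2r n0); apply: le_trans low (le_trans up _); rewrite mulrAC.
by rewrite /t ler_pdivrMr.
Qed.

Lemma sum_avg_height_le :
  n%:R^-1 * (\sum_(x : T) avg_height R x / (down_card x)%:R) <= 4 * C :> R.
Proof.
have [l [l0 lsum _ lh _]] := room_profile eta0 n1 unbalanced.
rewrite mulrC ler_pdivrMr//; apply: le_trans (ler_sum _ (fun x _ => lh x)) _.
rewrite -mulr_sumr (_ : 4 * C * n%:R = 8 * n%:R * (8 * (1 + 4 / eta) + 1)); last by ring.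
by rewrite ler_pM2l// mulr_gt0.
Qed.

Lemma ln_nlinexts_ratio_le :
  n%:R^-1 * ln (nlinexts T)%:R <= 1 + 4 / eta + ln 16 :> R.
Proof.
have [l [_ _ _ _ h]] := room_profile eta0 n1 unbalanced.
by rewrite mulrC ler_pdivrMr.
Qed.

(** Exchanging the sums, [l x] is weighted by the total mass of the antichains through [x], which is
    at most one. *)
Lemma fractional_matching_le (lam : {set T} -> R) : fractional_matching lam ->
  n%:R^-1 * (\sum_(A : {set T} | antichain A) lam A * #|A|%:R ^+ 2) <= C.
Proof.
move=> [lam01 lam1].
have [l [l0 lsum lA _ _]] := room_profile eta0 n1 unbalanced.
rewrite mulrC ler_pdivrMr//.
apply: (@le_trans _ _ (\sum_(A : {set T} | antichain A)
    lam A * (2 * n%:R * \sum_(a in A) l a))).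
  by apply: ler_sum => A AP; apply: ler_wpM2l (lA A AP); case/andP: (lam01 A AP).
have -> : \sum_(A : {set T} | antichain A) lam A * (2 * n%:R * \sum_(a in A) l a) =
    2 * n%:R * \sum_x l x * \sum_(A : {set T} | antichain A && (x \in A)) lam A.
  rewrite (eq_bigr (fun A : {set T} => 2 * n%:R *
      \sum_x (if x \in A then lam A * l x else 0))); last first.
    by move=> A _; rewrite mulrCA; congr (_ * _); rewrite mulr_sumr big_mkcond.
  rewrite -mulr_sumr exchange_big/=; congr (_ * _); apply: eq_bigr => x _.
  rewrite big_mkcondr/= mulr_sumr; apply: eq_bigr => A _.
  by case: ifP; rewrite ?mulr0// mulrC.
rewrite (_ : C * n%:R = 2 * n%:R * (8 * (1 + 4 / eta) + 1)); last by ring.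
rewrite ler_pM2l ?mulr_gt0//; apply: le_trans lsum; apply: ler_sum => x _.
by rewrite ler_piMr.
Qed.

End UnbalancedBounds.

Lemma height_gt0 (d : Order.disp_t) (T : finPOrderType d) : (0 < #|T|)%N ->
  (0 < height T)%N.
Proof.
move=> /card_gt0P[x _]; rewrite -(cards1 x); apply: leq_bigmax_cond.
by apply/chainP => a b /set1P-> /set1P->; apply: comparablexx.
Qed.

(** * Passage to the limit inferior *)

Local Open Scope classical_set_scope.

Lemma limn_einf_ge (R : realType) (u : (\bar R)^nat) (c : \bar R) :
  (\forall m \near \oo, (c <= u m)%E) -> (c <= limn_einf u)%E.
Proof.
move=> [M _ cu]; rewrite limn_einf_lim; apply: lime_ge; first exact: is_cvg_einfs.
exists M => // m Mm; apply: le_ereal_inf_tmp => _ [k mk <-].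
by apply: cu; apply: leq_trans mk.
Qed.

(** It suffices to lose [eta]: e^(-1 - eta) >= e^(-1) (1 - eta) >= e^(-1) - eta. *)
Lemma einv_le_limn_einf (R : realType) (u : nat -> R) :
  (forall eta : R, 0 < eta -> \forall m \near \oo, expR (- 1 - eta) <= u m) ->
  (((expR 1)^-1 : R)%:E <= limn_einf (fun m => (u m)%:E))%E.
Proof.
move=> H; apply/lee_addgt0Pr => eta eta0.
have /limn_einf_ge h : \forall m \near \oo, ((expR (- 1 - eta))%:E <= (u m)%:E)%E.
  by near=> m; rewrite lee_fin; near: m; apply: H.
apply: le_trans (leeD2r _ h); rewrite -EFinD lee_fin -expRN.
have : expR (- 1) * (1 + - eta) <= expR (- 1 - eta) :> R.
  by rewrite expRD ler_pM2l ?expR_gt0// expR_ge1Dx.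
have : expR (- 1) <= 1 :> R by rewrite expR_le1.
have := expR_gt0 (- 1 : R); nra.
Unshelve. all: by end_near.
Qed.

Theorem theorem1p7 (R : realType) (d : nat -> Order.disp_t)
    (P : forall m : nat, finPOrderType (d m))
    (card_P : (#|P m|%:R : R) @[m --> \oo] --> +oo)
    (hP :
      (((width (P m))%:R / Num.sqrt (#|P m|%:R) : R) @[m --> \oo] --> +oo) \/
      (((height (P m))%:R / #|P m|%:R : R) @[m --> \oo] --> (0 : R)) \/
      (((#|P m|%:R)^-1 *
          \sum_(x : P m) avg_height R x / (down_card x)%:R : R)
         @[m --> \oo] --> +oo) \/
      (((#|P m|%:R)^-1 * ln ((nlinexts (P m))%:R) : R)
         @[m --> \oo] --> +oo) \/
      (exists lam : forall m : nat, {set P m} -> R,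
         (forall m : nat, fractional_matching (lam m)) /\
         (((#|P m|%:R)^-1 *
             \sum_(A : {set P m} | antichain A) lam m A * (#|A|%:R) ^+ 2 : R)
            @[m --> \oo] --> +oo))) :
  (((expR 1)^-1 : R)%:E <= limn_einf (fun m : nat => (balance R (P m))%:E))%E.
Proof.
apply: einv_le_limn_einf => eta eta0.
pose C : R := 2 * (8 * (1 + 4 / eta) + 1).
have C0 : 0 < C by rewrite mulr_gt0// addr_gt0// mulr_gt0// addr_gt0// divr_gt0.
have n2 : \forall m \near \oo, (1 < #|P m|)%N.
  apply: filterS _ ((cvgryPge _).1 card_P 2) => m.
  by rewrite ler_nat.
case: hP => [ha|[hb|[hc|[hd|[lam [lamP he]]]]]].
(* All cases go by contraposition: a balance below e^(-1 - eta) would bound the quantity at index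
   [m] against the assumed limit. *)
- apply: filterS2 _ n2 ((cvgryPge _).1 ha (C + 1)) => m {}n2.
  apply: contraTT; rewrite -!ltNge => unb.
  have n0 : 0 < #|P m|%:R :> R by rewrite ltr0n ltnW.
  have s0 : 0 < Num.sqrt #|P m|%:R :> R by rewrite sqrtr_gt0.
  rewrite ltr_pdivrMr// -(ltr_pXn2r (ltn0Sn 1)) ?nnegrE
    ?mulr_ge0 ?addr_ge0 ?(ltW C0) ?(ltW s0)//.
  apply: le_lt_trans (width_le eta0 n2 unb) _.
  rewrite exprMn sqr_sqrtr ?(ltW n0)// ltr_pM2r// -/C expr2.
  by nra.
(* The 2 in the threshold absorbs the passage from height + 1 to twice the height. *)
- have C2 : 0 < (C * 2)^-1 by rewrite invr_gt0 mulr_gt0.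
  apply: filterS2 _ n2 ((cvgr0Pnorm_lt _).1 hb _ C2) => m {}n2.
  apply: contraTT; rewrite -!ltNge -leNgt => unb.
  have n0 : 0 < #|P m|%:R :> R by rewrite ltr0n ltnW.
  rewrite ger0_norm ?divr_ge0// ler_pdivlMr// -ler_pdivlMl// invrK.
  apply: le_trans (card_le_height eta0 n2 unb : _ <= C * _) _.
  rewrite -[leRHS]mulrA ler_pM2l// -natrM ler_nat.
  by have := height_gt0 (ltnW n2); lia.
- apply: filterS2 _ n2 ((cvgryPge _).1 hc (4 * C + 1)) => m {}n2.
  apply: contraTT; rewrite -!ltNge => unb.
  apply: le_lt_trans (sum_avg_height_le eta0 n2 unb) _.
  by rewrite ltrDl.
- apply: filterS2 _ n2 ((cvgryPge _).1 hd (1 + 4 / eta + ln 16 + 1)) => m {}n2.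
  apply: contraTT; rewrite -!ltNge => unb.
  apply: le_lt_trans (ln_nlinexts_ratio_le eta0 n2 unb) _.
  by rewrite ltrDl.
- apply: filterS2 _ n2 ((cvgryPge _).1 he (C + 1)) => m {}n2.
  apply: contraTT; rewrite -!ltNge => unb.
  apply: le_lt_trans (fractional_matching_le eta0 n2 unb (lamP m)) _.
  by rewrite ltrDl.
Qed.
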